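(* The following decision problem is at least as hard as CSRI, i.e. CSRI is polynomial-time reducible to it: given a strongly connected Markov chain $\mathsf{M}=(S,\delta)$ with rational transition probabilities, a reward function $r\colon S\to\mathbb{Q}_{>0}$, and a state $\hat s\in S$, decide whether $\mathbb{E}_{\mathsf{M},\hat s}[\mathrm{MP}_{\log(r)}]>0$.
   Context: Markov chains are finite. For a function $w\colon S\to\mathbb{R}$ and an infinite path $\rho=\rho_0\rho_1\cdots$, the mean payoff is $\mathrm{MP}_w(\rho)=\lim_{n\to\infty}\frac1{n+1}\sum_{i=0}^n w(\rho_i)$ (in finite Markov chains the limsup and liminf versions agree almost surely); here $w=\log(r)=\log\circ r$. In a strongly connected Markov chain the expected mean payoff does not depend on the start state. Rational numbers are encoded as fractions of co-prime integers in binary. CSRI (comparison of succinctly represented integers): given natural numbers $a_1,\dots,a_n,b_1,\dots,b_n,c_1,\dots,c_m,d_1,\dots,d_m$ in binary, decide whether $a_1^{b_1}\cdots a_n^{b_n}>c_1^{d_1}\cdots c_m^{d_m}$. *)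

(* Defs.v *)
From HB Require Import structures.
From mathcomp Require Import all_boot all_order all_algebra.
From mathcomp Require Import all_classical all_reals all_analysis.

Set Implicit Arguments.
Unset Strict Implicit.
Unset Printing Implicit Defensive.

Import Order.TTheory GRing.Theory Num.Theory.
Local Open Scope ring_scope.

(** * Deterministic multi-tape Turing machines *)

Inductive move := GoLeft | Stay | GoRight.

(* A two-way infinite tape.  [tleft] lists the cells to the left of the head,
   nearest first, and [tright] those to its right; cells beyond the ends of
   these lists are blank. *)
Record tape (G : Type) := Tape { tleft : seq G; tcur : G; tright : seq G }.

Definition tape_act (G : Type) (blank : G) (t : tape G) (am : G * move) :
    tape G :=
  let: (a, m) := am in
  match m with
  | GoLeft =>
      Tape (behead (tleft t)) (head blank (tleft t)) (a :: tright t)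
  | Stay => Tape (tleft t) a (tright t)
  | GoRight =>
      Tape (a :: tleft t) (head blank (tright t)) (behead (tright t))
  end.

(* Cells carry [None] (blank), a letter of the input alphabet [Sigma], or an
   auxiliary letter from [tm_work]. *)
Record tm (Sigma : finType) := TM {
  tm_tapes : nat; (* the number of tapes, minus one *)
  tm_work : finType;
  tm_state : finType;
  tm_start : tm_state;
  tm_halt : pred tm_state;
  tm_trans : tm_state ->
             {ffun 'I_tm_tapes.+1 -> option (Sigma + tm_work)} ->
             tm_state *
             {ffun 'I_tm_tapes.+1 -> option (Sigma + tm_work) * move}
}.

Section TMSemantics.
Variables (Sigma : finType) (M : tm Sigma).

Definition tm_letter : Type := option (Sigma + tm_work M).

Definition tm_config : Type :=
  tm_state M * {ffun 'I_(tm_tapes M).+1 -> tape tm_letter}.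

Definition tape_of_word (w : seq Sigma) : tape tm_letter :=
  let s := [seq Some (inl a) | a <- w] in Tape [::] (head None s) (behead s).

Definition tm_init (w : seq Sigma) : tm_config :=
  (tm_start M,
   [ffun i => if i == ord0 then tape_of_word w else tape_of_word [::]]).

Definition tm_step (c : tm_config) : tm_config :=
  if tm_halt c.1 then c else
  let qa := tm_trans c.1 [ffun i => tcur (c.2 i)] in
  (qa.1, [ffun i => tape_act None (c.2 i) (qa.2 i)]).

Fixpoint word_prefix (s : seq tm_letter) : seq Sigma :=
  if s is Some (inl a) :: s' then a :: word_prefix s' else [::].

(* The output is the maximal word over the input alphabet that starts under
   the head of the last tape. *)
Definition tm_output (c : tm_config) : seq Sigma :=
  let t := c.2 ord_max in word_prefix (tcur t :: tright t).

Definition tm_computes_in (T : nat) (w v : seq Sigma) : Prop :=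
  let c := iter T tm_step (tm_init w) in
  tm_halt c.1 /\ tm_output c = v.

End TMSemantics.

(** * Decision problems and polynomial-time many-one reductions *)

Record problem (Sigma : finType) := Problem {
  instance : Type;
  encode : instance -> seq Sigma;
  yes : instance -> Prop
}.

Definition polytime_computable (Sigma : finType) (A B : problem Sigma)
    (f : instance A -> instance B) : Prop :=
  exists (M : tm Sigma) (c d : nat), forall x : instance A,
    tm_computes_in M (c * size (encode x) ^ d + c)%N
                   (encode x) (encode (f x)).

Definition polytime_reducible (Sigma : finType) (A B : problem Sigma) : Prop :=
  exists f : instance A -> instance B,
    polytime_computable f /\ (forall x, yes x <-> yes (f x)).

(** * Encodings *)

Inductive symbol := Bit of bool | Slash | Comma | Semicolon | Hash.

Definition symbol_code (x : symbol) : bool + 'I_4 :=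
  match x with
  | Bit b => inl b
  | Slash => inr (inord 0)
  | Comma => inr (inord 1)
  | Semicolon => inr (inord 2)
  | Hash => inr (inord 3)
  end.

Definition symbol_decode (c : bool + 'I_4) : symbol :=
  match c with
  | inl b => Bit b
  | inr i => nth Hash [:: Slash; Comma; Semicolon; Hash] i
  end.

Lemma symbol_codeK : cancel symbol_code symbol_decode.
Proof. by case=> [b||||] //=; rewrite inordK. Qed.

HB.instance Definition _ := Finite.copy symbol (can_type symbol_codeK).

(* Most significant bit first, without leading zeros; 0 is written "0". *)
Definition enc_nat (n : nat) : seq symbol :=
  [seq Bit (odd (n %/ 2 ^ i)) | i <- rev (iota 0 (trunc_log 2 n).+1)].

(* Only used for nonnegative rationals, hence no sign.  [numq q] and [denq q]
   are coprime. *)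
Definition enc_rat (q : rat) : seq symbol :=
  enc_nat `|numq q|%N ++ Slash :: enc_nat `|denq q|%N.

(** * Comparison of succinctly represented integers *)

(* ([:: (a_1, b_1); ...; (a_n, b_n)], [:: (c_1, d_1); ...; (c_m, d_m)]) *)
Definition csri_instance : Type := (seq (nat * nat) * seq (nat * nat))%type.

(* a_1,b_1;...a_n,b_n;#c_1,d_1;...c_m,d_m; *)
Definition enc_powers (s : seq (nat * nat)) : seq symbol :=
  flatten [seq enc_nat ab.1 ++ Comma :: enc_nat ab.2 ++ [:: Semicolon]
          | ab <- s].

Definition enc_csri (x : csri_instance) : seq symbol :=
  enc_powers x.1 ++ Hash :: enc_powers x.2.

Definition csri_yes (x : csri_instance) : Prop :=
  (\prod_(ab <- x.1) ab.1 ^ ab.2 > \prod_(cd <- x.2) cd.1 ^ cd.2)%N.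

Definition CSRI : problem symbol :=
  @Problem symbol csri_instance enc_csri csri_yes.

(** * Markov chains and expected mean payoff *)

Section MarkovChain.
Variable (S : finType).

Definition is_markov_chain (delta : S -> S -> rat) : Prop :=
  (forall s t, 0 <= delta s t) /\ (forall s, \sum_t delta s t = 1).

Definition strongly_connected (delta : S -> S -> rat) : Prop :=
  forall s t, connect [rel u v | 0 < delta u v] s t.

(* Infinite paths.  The state [s0] only witnesses that this type is
   inhabited, as the library asks of measurable spaces. *)
Definition path_space (s0 : S) : Type := nat -> S.

HB.instance Definition _ (s0 : S) :=
  Choice.copy (path_space s0) (nat -> S).
HB.instance Definition _ (s0 : S) :=
  isPointed.Build (path_space s0) (fun=> s0).

Definition cylinder (s0 : S) (n : nat) (p : nat -> S) : set (path_space s0) :=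
  [set rho | forall i, (i <= n)%N -> rho i = p i]%classic.

Definition cylinders (s0 : S) : set (set (path_space s0)) :=
  [set A | exists n p, A = @cylinder s0 n p]%classic.

(* Paths with the sigma-algebra generated by the cylinders. *)
Definition path_sigma (s0 : S) : Type := g_sigma_algebraType (@cylinders s0).

Variable (R : realType).

(* [P] is the law of the chain started in [s0]; it is determined by the values
   on cylinders. *)
Definition is_path_measure (delta : S -> S -> rat) (s0 : S)
    (P : probability (path_sigma s0) R) : Prop :=
  forall (n : nat) (p : nat -> S),
    P (@cylinder s0 n p) =
    ((p 0%N == s0)%:R * \prod_(i < n) ratr (delta (p i) (p i.+1)))%:E.

(* The lower limit exists for every path; it is the limit for almost every
   path of a finite Markov chain. *)
Definition mean_payoff (w : S -> R) (rho : nat -> S) : \bar R :=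
  limn_einf (fun n => (n.+1%:R^-1 * \sum_(i < n.+1) w (rho i))%:E).

Definition expected_mean_payoff (w : S -> R) (s0 : S)
    (P : probability (path_sigma s0) R) : \bar R :=
  (\int[P]_rho mean_payoff w rho)%E.

End MarkovChain.

(** * The mean-payoff problem for logarithmic rewards *)

Record log_mp_instance := LogMPInstance {
  mc_size : nat;
  mc_trans : 'I_mc_size -> 'I_mc_size -> rat;
  mc_reward : 'I_mc_size -> rat;
  mc_state : 'I_mc_size;
  mc_transP : is_markov_chain mc_trans;
  mc_connected : strongly_connected mc_trans;
  mc_reward_gt0 : forall s, 0 < mc_reward s
}.

(* The transition matrix, row by row, then the rewards, then the state:
   d_00,d_01,...,;d_10,d_11,...,;...#r_0,r_1,...,#s *)
Definition enc_log_mp (x : log_mp_instance) : seq symbol :=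
  let I := enum 'I_(mc_size x) in
  let enc_row (f : 'I_(mc_size x) -> rat) :=
    flatten [seq enc_rat (f t) ++ [:: Comma] | t <- I] in
  flatten [seq enc_row (mc_trans s) ++ [:: Semicolon] | s <- I]
  ++ Hash :: enc_row (@mc_reward x)
  ++ Hash :: enc_nat (mc_state x).

(* The path measure exists and is unique. *)
Definition log_mp_yes (R : realType) (x : log_mp_instance) : Prop :=
  exists2 P : probability (path_sigma (mc_state x)) R,
    is_path_measure (@mc_trans x) P
    & (0 < expected_mean_payoff (fun s => ln (ratr (mc_reward s))) P)%E.

Definition LogMP (R : realType) : problem symbol :=
  @Problem symbol log_mp_instance enc_log_mp (log_mp_yes R).

(* Main.v *)
(** The chain is built so that its steps are independent and identically
    distributed: all rows of the transition matrix equal one vector [p] of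
    positive dyadic probabilities, so by the strong law of large numbers the
    mean payoff is almost surely [\sum_s p s * ln (r s)].  A factor [a ^ b] of
    the left product gives four states with rewards [a], [1/a], [1/a], [a] and
    probabilities
      [(2^(k+1) + (2b+1)) / 2^(L+4)],  [(2^(k+1) - (2b+1)) / 2^(L+4)],
      [(2^(k+1) + 1) / 2^(L+4)],       [(2^(k+1) - 1) / 2^(L+4)],
    which contribute [4 b ln a / 2^(L+4)]; a factor of the right product gives
    the same states with inverted rewards.  Here [L] is the length of the input
    and [L - k] is the number of later factors, so the factors receive the total
    masses 1/2, 1/4, 1/8, ... (from the last one to the first), and one more
    state, with reward 1, receives the rest.  All numerators are odd: the
    fractions are in lowest terms, and the machine writes them by copying,
    complementing and padding bit strings, without any arithmetic.  A product
    that is 0 because of a factor [0 ^ b] with [0 < b] is detected by a finite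
    automaton and leads to one of two constant instances.

    The law of large numbers follows from the summability of the fourth moments
    of the deviations; the path measure is the image of Lebesgue measure on
    [0,1[ under an expansion into digits whose cells have lengths [p s]. *)

Require Import Defs.
From HB Require Import structures.
From mathcomp Require Import all_boot all_order all_algebra.
From mathcomp Require Import all_classical all_reals all_analysis.
From mathcomp Require Import measurable_realfun.
From mathcomp Require Import zify ring lra.

Set Implicit Arguments.
Unset Strict Implicit.
Unset Printing Implicit Defensive.

(** * Structured programs on five tapes *)

Section Programs.
Variable W : finType.

Definition letter : Type := option (symbol + W).
Definition op : Type := letter -> letter * move.

Record reads := Reads { r0 : letter; r1 : letter; r2 : letter; r3 : letter;
                        r4 : letter }.
Record ops := Ops { o0 : op; o1 : op; o2 : op; o3 : op; o4 : op }.
Record tapes := Tapes { t0 : tape letter; t1 : tape letter; t2 : tape letter;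
                        t3 : tape letter; t4 : tape letter }.

Definition reads_of (T : tapes) : reads :=
  Reads (tcur (t0 T)) (tcur (t1 T)) (tcur (t2 T)) (tcur (t3 T)) (tcur (t4 T)).

Definition op_act (o : op) (t : tape letter) : tape letter :=
  tape_act None t (o (tcur t)).

Definition ops_act (a : ops) (T : tapes) : tapes :=
  Tapes (op_act (o0 a) (t0 T)) (op_act (o1 a) (t1 T)) (op_act (o2 a) (t2 T))
        (op_act (o3 a) (t3 T)) (op_act (o4 a) (t4 T)).

Definition hold : op := fun c => (c, Stay).
Definition goL : op := fun c => (c, GoLeft).
Definition goR : op := fun c => (c, GoRight).
Definition put (x : letter) : op := fun=> (x, Stay).
Definition pushL (x : letter) : op := fun=> (x, GoLeft).
Definition pushR (x : letter) : op := fun=> (x, GoRight).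

Definition idle : ops := Ops hold hold hold hold hold.

Inductive prog :=
| Prim of (reads -> ops)
| Seq of prog & prog
| While of (reads -> bool) & prog
| If of (reads -> bool) & prog & prog.

(** Big-step semantics with an exact step count. Each test of a loop or conditional costs one step,
    since it gets a state of its own in the compiled machine. *)
Inductive exec : prog -> nat -> tapes -> tapes -> Prop :=
| ExecPrim f T : exec (Prim f) 1 T (ops_act (f (reads_of T)) T)
| ExecSeq p q n m T T' T'' :
    exec p n T T' -> exec q m T' T'' -> exec (Seq p q) (n + m) T T''
| ExecWhileF (b : reads -> bool) p T : ~~ b (reads_of T) ->
    exec (While b p) 1 T T
| ExecWhileT (b : reads -> bool) p n m T T' T'' : b (reads_of T) ->
    exec p n T T' -> exec (While b p) m T' T'' ->
    exec (While b p) (n.+1 + m) T T''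
| ExecIfT (b : reads -> bool) p q n T T' : b (reads_of T) -> exec p n T T' ->
    exec (If b p q) n.+1 T T'
| ExecIfF (b : reads -> bool) p q n T T' : ~~ b (reads_of T) -> exec q n T T' ->
    exec (If b p q) n.+1 T T'.

(** * Compilation of programs to transition functions *)

Fixpoint pstate (p : prog) : finType :=
  match p with
  | Prim _ => unit : finType
  | Seq p q => (pstate p + pstate q)%type : finType
  | While _ p => (unit + pstate p)%type : finType
  | If _ p q => (unit + (pstate p + pstate q))%type : finType
  end.

Fixpoint pstart (p : prog) : pstate p :=
  match p return pstate p with
  | Prim _ => tt
  | Seq p _ => inl (pstart p)
  | While _ _ => inl tt
  | If _ _ _ => inl tt
  end.

(* [k] is where the composite program continues when the component exits. *)
Definition relabel (Q Q' : Type) (emb : Q -> Q') (k : option Q')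
    (x : option Q * ops) : option Q' * ops :=
  (if x.1 is Some q then Some (emb q) else k, x.2).

Fixpoint pstep (p : prog) : pstate p -> reads -> option (pstate p) * ops :=
  match p return pstate p -> reads -> option (pstate p) * ops with
  | Prim f => fun _ r => (None, f r)
  | Seq p q => fun s r =>
      match s with
      | inl s => relabel inl (Some (inr (pstart q))) (pstep s r)
      | inr s => relabel inr None (pstep s r)
      end
  | While b p => fun s r =>
      match s with
      | inl _ => (if b r then Some (inr (pstart p)) else None, idle)
      | inr s => relabel inr (Some (inl tt)) (pstep s r)
      end
  | If b p q => fun s r =>
      match s with
      | inl _ =>
          (Some (inr (if b r then inl (pstart p) else inr (pstart q))), idle)
      | inr (inl s) => relabel (fun s => inr (inl s)) None (pstep s r)
      | inr (inr s) => relabel (fun s => inr (inr s)) None (pstep s r)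
      end
  end.

Section Run.
Variables (Q : Type) (delta : Q -> reads -> option Q * ops).

(** A run has at least one step and passes through proper states only, except that its last step may
    exit, which is recorded by the outcome [None]. *)
Inductive run : Q -> nat -> tapes -> option Q -> tapes -> Prop :=
| Run1 q T : run q 1 T (delta q (reads_of T)).1
                   (ops_act (delta q (reads_of T)).2 T)
| RunS q q' n T o T' : (delta q (reads_of T)).1 = Some q' ->
    run q' n (ops_act (delta q (reads_of T)).2 T) o T' -> run q n.+1 T o T'.

Lemma run_trans q n T q' T' m o T'' :
  run q n T (Some q') T' -> run q' m T' o T'' -> run q (n + m) T o T''.
Proof.
move=> H; move: {-2}(Some q') H (erefl (Some q')) => o' H.
elim: H => {q n T o' T'} [q T|q q1 n T o' T' dq _ IH] eo H2.
  by apply: RunS H2.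
by rewrite addSn; apply: RunS dq _; apply: IH.
Qed.

End Run.

(** A run exits in its last step only, so the embedded component can be followed step by step and
    the exit replaced by the continuation [k] at the end. *)
Lemma run_relabel (Q Q' : Type) (d : Q -> reads -> option Q * ops)
    (d' : Q' -> reads -> option Q' * ops) (emb : Q -> Q') k :
  (forall q r, d' (emb q) r = relabel emb k (d q r)) ->
  forall q n T T', run d q n T None T' -> run d' (emb q) n T k T'.
Proof.
move=> E q n T T' H; move: {-2}None H (erefl (None : option Q)) => o H.
elim: H => {q n T o T'} [q T|q q1 n T o T' dq _ IH] eo.
  have -> : k = (d' (emb q) (reads_of T)).1 by rewrite E /relabel -eo.
  have -> : (d q (reads_of T)).2 = (d' (emb q) (reads_of T)).2 by rewrite E.
  exact: Run1.
apply: (@RunS _ _ _ (emb q1)); first by rewrite E /relabel dq.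
by rewrite E; apply: IH.
Qed.

Lemma ops_act_idle T : ops_act idle T = T.
Proof. by case: T => [[? ? ?] [? ? ?] [? ? ?] [? ? ?] [? ? ?]]. Qed.

Lemma exec_run p n T T' :
  exec p n T T' -> run (@pstep p) (pstart p) n T None T'.
Proof.
elim=> {p n T T'}.
- by move=> f T; exact: (@Run1 _ (@pstep (Prim f)) tt).
- move=> p q n m T T' T'' _ Hp _ Hq.
  have Hp' : run (@pstep (Seq p q)) (inl (pstart p)) n T
                 (Some (inr (pstart q))) T' by apply: run_relabel Hp.
  by apply: run_trans Hp' _; apply: run_relabel Hq.
- move=> b p T /negbTE bF.
  rewrite -{2}[T]ops_act_idle.
  by have := @Run1 _ (@pstep (While b p)) (inl tt) T; rewrite /= bF.
- move=> b p n m T T' T'' bT _ Hp _ Hw.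
  rewrite addSn; apply: (@RunS _ (@pstep (While b p)) _ (inr (pstart p))).
    by rewrite /= bT.
  rewrite ops_act_idle; apply: run_trans Hw.
  by apply: run_relabel Hp.
- move=> b p q n T T' bT _ Hp.
  apply: (@RunS _ (@pstep (If b p q)) _ (inr (inl (pstart p)))).
    by rewrite /= bT.
  by rewrite ops_act_idle; 
     apply: (run_relabel (emb := fun s => inr (inl s))) Hp.
- move=> b p q n T T' /negbTE bF _ Hq.
  apply: (@RunS _ (@pstep (If b p q)) _ (inr (inr (pstart q)))).
    by rewrite /= bF.
  by rewrite ops_act_idle; 
     apply: (run_relabel (emb := fun s => inr (inr s))) Hq.
Qed.

(** * From compiled programs to Turing machines with five tapes *)

Definition reads_of_ffun (f : {ffun 'I_5 -> letter}) : reads :=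
  Reads (f (inord 0)) (f (inord 1)) (f (inord 2)) (f (inord 3)) (f (inord 4)).

Definition ops_nth (a : ops) (i : nat) : op :=
  nth hold [:: o0 a; o1 a; o2 a; o3 a; o4 a] i.

Definition tapes_nth (T : tapes) (i : nat) : tape letter :=
  nth (t0 T) [:: t0 T; t1 T; t2 T; t3 T; t4 T] i.

(** Exiting the program means entering the additional state [None], the halting state of the
    machine. *)
Definition prog_tm (p : prog) : tm symbol :=
  @TM symbol 4 W (option (pstate p) : finType) (Some (pstart p))
    (fun o => ~~ isSome o)
    (fun o f =>
       match o with
       | None => (None, [ffun i => (f i, Stay)])
       | Some q =>
           let x := pstep q (reads_of_ffun f) in
           (x.1, [ffun i : 'I_5 => ops_nth x.2 i (f i)])
       end).

Definition tm_tapes_of (T : tapes) : {ffun 'I_5 -> tape letter} :=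
  [ffun i : 'I_5 => tapes_nth T i].

Lemma tm_step_prog p q T :
  @tm_step symbol (prog_tm p) (Some q, tm_tapes_of T) =
  ((pstep q (reads_of T)).1,
   tm_tapes_of (ops_act (pstep q (reads_of T)).2 T)).
Proof.
rewrite /tm_step /=.
have -> : reads_of_ffun [ffun i => tcur (tm_tapes_of T i)] = reads_of T.
  by rewrite /reads_of_ffun !ffunE !inordK.
congr (_, _); apply/ffunP => i; rewrite !ffunE.
by case: i => [[|[|[|[|[|i]]]]] Hi].
Qed.

Lemma run_iter p q n T T' : run (@pstep p) q n T None T' ->
  iter n (@tm_step symbol (prog_tm p)) (Some q, tm_tapes_of T) =
  (None, tm_tapes_of T').
Proof.
move=> H; move: {-2}None H (erefl (None : option (pstate p))) => o H.
elim: H => {q n T o T'} [q T|q q1 n T o T' dq _ IH] eo.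
  by rewrite /= tm_step_prog -eo.
by rewrite iterSr tm_step_prog dq IH.
Qed.

Definition init_tapes (w : seq symbol) : tapes :=
  let b := Tape [::] (None : letter) [::] in
  Tapes (Tape [::] (head None [seq Some (inl a) | a <- w])
              (behead [seq Some (inl a) | a <- w])) b b b b.

Fixpoint oword (s : seq letter) : seq symbol :=
  if s is Some (inl a) :: s' then a :: oword s' else [::].

Definition exec_le p n T T' := exists2 m, m <= n & exec p m T T'.

(** A halted configuration is a fixed point of [tm_step], so an upper bound on the running time is
    enough. *)
Lemma prog_tm_computes p n w T : exec_le p n (init_tapes w) T ->
  @tm_computes_in symbol (prog_tm p) n w
    (oword (tcur (t4 T) :: tright (t4 T))).
Proof.
case=> m le_mn /exec_run/run_iter Hm; rewrite /tm_computes_in.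
have -> : tm_init (prog_tm p) w = (Some (pstart p), tm_tapes_of (init_tapes w)).
  congr (_, _); apply/ffunP => i; rewrite !ffunE.
  by case: i => [[|[|[|[|[|i]]]]] Hi].
rewrite -(subnK le_mn) iterD Hm.
have -> k : iter k (@tm_step symbol (prog_tm p)) (None, tm_tapes_of T) =
            (None, tm_tapes_of T).
  by elim: k => //= k ->.
split=> //; rewrite /tm_output /= ffunE /=.
have E s : @word_prefix symbol (prog_tm p) s = oword s.
  by elim: s => //= [[[a|//]|//]] s' ->.
by rewrite -E.
Qed.

Lemma exec_le_prim f n T : 0 < n ->
  exec_le (Prim f) n T (ops_act (f (reads_of T)) T).
Proof. by move=> ?; exists 1 => //; apply: ExecPrim. Qed.

Lemma exec_le_seq p q n m T T' T'' :
  exec_le p n T T' -> exec_le q m T' T'' -> exec_le (Seq p q) (n + m) T T''.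
Proof.
move=> [k kn Hp] [l lm Hq]; exists (k + l); first exact: leq_add.
exact: ExecSeq Hp Hq.
Qed.

Lemma exec_le_trans p n m T T' :
  exec_le p n T T' -> n <= m -> exec_le p m T T'.
Proof. by case=> k kn Hp nm; exists k => //; apply: leq_trans nm. Qed.

Lemma exec_le_ifT (b : reads -> bool) p q n T T' : b (reads_of T) ->
  exec_le p n T T' -> exec_le (If b p q) n.+1 T T'.
Proof. by move=> bT [k kn H]; exists k.+1 => //; apply: ExecIfT. Qed.

Lemma exec_le_ifF (b : reads -> bool) p q n T T' : ~~ b (reads_of T) ->
  exec_le q n T T' -> exec_le (If b p q) n.+1 T T'.
Proof. by move=> bT [k kn H]; exists k.+1 => //; apply: ExecIfF. Qed.

(* [st done rest] is the configuration when the loop still has to process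
   [rest] and has processed the reversal of [done]. *)
Lemma exec_le_while (X : Type) (st : seq X -> seq X -> tapes)
    (b : reads -> bool) p n s :
  (forall u x v, s = catrev u (x :: v) -> b (reads_of (st u (x :: v))) /\
     exec_le p n (st u (x :: v)) (st (x :: u) v)) ->
  ~~ b (reads_of (st (rev s) [::])) ->
  exec_le (While b p) (n.+1 * size s + 1) (st [::] s) (st (rev s) [::]).
Proof.
move=> Hs HF.
suff G u v : s = catrev u v ->
    exec_le (While b p) (n.+1 * size v + 1) (st u v) (st (rev s) [::]).
  exact: (G [::] s).
elim: v u => [|x v IH] u Es.
  have -> : u = rev s by rewrite Es catrevE cats0 revK.
  by exists 1; [rewrite muln0|apply: ExecWhileF].
have [bT [k kn Hp]] := Hs _ _ _ Es.
have [m lm Hw] := IH (x :: u) Es.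
exists (k.+1 + m); last exact: ExecWhileT Hp Hw.
by rewrite /= mulnS -addnA leq_add.
Qed.

End Programs.

(** * The program for the reduction *)

(* The state [(sec, fA, fC, pos)] of the automaton that scans the input: [sec]
   after '#'; [fA], [fC] if a factor [0 ^ b] with [0 < b] was met before,
   respectively after, '#'; [pos] is the position in the current factor: at its
   start, after the base 0, at the exponent of the base 0, anywhere else.  A base
   0 is overwritten by 1, which is harmless for [0 ^ 0]. *)
Definition dstate : finType := (bool * bool * bool * (bool * bool))%type.

Definition cell := letter dstate.
Definition sy (x : symbol) : cell := Some (inl x).

(** Numerals have no leading zeros, so the first bit of a numeral already decides whether the number
    is 0. This is why a finite automaton detects [0 ^ b] with [0 < b]. *)
Definition dfa (s : dstate) (x : symbol) : dstate * symbol :=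
  let: (sec, fA, fC, pos) := s in
  match pos with
  | (false, false) =>
      match x with
      | Bit false => ((sec, fA, fC, (false, true)), Bit true)
      | Hash => ((true, fA, fC, pos), x)
      | _ => ((sec, fA, fC, (true, true)), x)
      end
  | (false, true) => ((sec, fA, fC, (true, false)), x)
  | (true, false) =>
      let z := if x is Bit b then b else false in
      ((sec, fA || ~~ sec && z, fC || sec && z, (true, true)), x)
  | (true, true) =>
      ((sec, fA, fC, if x is Semicolon then (false, false) else pos), x)
  end.

Local Notation "p ;; q" := (Seq p q) (at level 60, right associativity).

Arguments hold {W}.
Arguments goL {W}.
Arguments goR {W}.
Local Notation dprog := (prog dstate).
Local Notation dtapes := (tapes dstate).
Local Notation dop := (op dstate).

Definition act5 (a b c d e : dop) : dprog := Prim (fun=> Ops a b c d e).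

Definition unused : cell := sy (Bit false).
Definition used : cell := sy (Bit true).

Definition is_unused (c : cell) : bool :=
  if c is Some (inl (Bit false)) then true else false.
Definition is_bit (c : cell) : bool :=
  if c is Some (inl (Bit _)) then true else false.
Definition is_used (c : cell) : bool :=
  if c is Some (inl (Bit true)) then true else false.
Definition is_semi (c : cell) : bool :=
  if c is Some (inl Semicolon) then true else false.
Definition is_comma_cell (c : cell) : bool :=
  if c is Some (inl Comma) then true else false.

Definition pushBit (neg : bool) (c : cell) : dop :=
  pushL (if c is Some (inl (Bit b)) then sy (Bit (neg (+) b)) else None).

(* Tape 0 is the input, read from right to left after the scan; tape 1 is a
   counter [unused ^ k used ^ i] with head to its right; tapes 2, 3 and 4, all
   written from right to left, hold a row of the matrix, the rewards, and the
   output (during the scan: the state of the automaton). *)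

Definition push2 (x : symbol) : dprog :=
  act5 hold hold (pushL (sy x)) hold hold.
Definition push3 (x : symbol) : dprog :=
  act5 hold hold hold (pushL (sy x)) hold.
Definition push4 (x : symbol) : dprog :=
  act5 hold hold hold hold (pushL (sy x)).

Definition mv0 (o : dop) : dprog := act5 o hold hold hold hold.
Definition mv1 (o : dop) : dprog := act5 hold o hold hold hold.
Definition mv2 (o : dop) : dprog := act5 hold hold o hold hold.
Definition mv3 (o : dop) : dprog := act5 hold hold hold o hold.
Definition mv4 (o : dop) : dprog := act5 hold hold hold hold o.

Definition home1 : dprog := While (fun r => isSome (r1 r)) (mv1 goR).

(** The counter has one mark per input letter, so walking over all of it emits [L] zeros. With the
    four zeros and the leading 1 from [entry_prog] they form the denominator [2 ^ (L + 4)]. *)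
Definition den_prog : dprog :=
  mv1 goL ;;
  While (fun r => isSome (r1 r))
    (act5 hold goL (pushL (sy (Bit false))) hold hold) ;;
  mv1 goR ;; home1.

Definition bits_prog (neg : bool) : dprog :=
  act5 goL goL hold hold hold ;;
  While (fun r => is_bit (r0 r))
    (Prim (fun r => Ops goL goL (pushBit neg (r0 r)) hold hold)) ;;
  mv0 goR ;;
  While (fun r => ~~ is_semi (r0 r)) (mv0 goR).

Definition pad_prog (neg : bool) : dprog :=
  While (fun r => is_unused (r1 r))
    (act5 hold goL (pushL (sy (Bit neg))) hold hold) ;;
  (if neg then act5 hold hold hold hold hold else push2 (Bit true)) ;;
  mv1 goR ;; home1.

Definition entry_prog (neg useb : bool) : dprog :=
  push2 Comma ;;
  push2 (Bit false) ;; push2 (Bit false) ;; push2 (Bit false) ;;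
  push2 (Bit false) ;;
  den_prog ;;
  push2 (Bit true) ;; push2 Slash ;; push2 (Bit true) ;;
  (if useb then bits_prog neg else mv1 goL) ;;
  pad_prog neg.

Definition copy_prog : dprog :=
  While (fun r => is_bit (r0 r))
    (Prim (fun r => Ops goL hold hold (pushBit false (r0 r)) hold)).

Definition reward_prog (inv : bool) : dprog :=
  act5 goL hold hold (pushL (sy Comma)) hold ;;
  (if inv then copy_prog ;; push3 Slash ;; push3 (Bit true)
   else push3 (Bit true) ;; push3 Slash ;; copy_prog) ;;
  mv0 goR ;;
  While (fun r => is_bit (r0 r)) (mv0 goR).

Definition count_prog : dprog :=
  mv1 goL ;;
  While (fun r => is_unused (r1 r)) (mv1 goL) ;;
  mv1 goR ;;
  mv1 (put used) ;;
  home1.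

Definition skip_bits : dprog :=
  mv0 goL ;; While (fun r => is_bit (r0 r)) (mv0 goL).

(** Tapes are filled from right to left, so the last entry of the row comes first. The exponent is
    copied with the head of tape 0 on the semicolon, the base with the head on the comma; finally
    one mark becomes used. *)
Definition item_prog (sg : bool) : dprog :=
  entry_prog true false ;; entry_prog false false ;;
  entry_prog true true ;; entry_prog false true ;;
  skip_bits ;;
  reward_prog (~~ sg) ;; reward_prog sg ;; reward_prog sg ;;
  reward_prog (~~ sg) ;;
  skip_bits ;;
  count_prog.

Definition items_prog (sg : bool) : dprog :=
  While (fun r => is_semi (r0 r)) (item_prog sg).

(** Once all factors are processed, the used marks count them; one zero per used mark gives the
    denominator [2 ^ n] of the remaining mass for [n] factors. *)
Definition filler_prog : dprog :=
  push2 Comma ;;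
  mv1 goL ;;
  While (fun r => is_unused (r1 r)) (mv1 goL) ;;
  While (fun r => is_used (r1 r))
    (act5 hold goL (pushL (sy (Bit false))) hold hold) ;;
  push2 (Bit true) ;; push2 Slash ;; push2 (Bit true) ;;
  push3 Comma ;; push3 (Bit true) ;; push3 Slash ;; push3 (Bit true).

Definition home2 : dprog := While (fun r => isSome (r2 r)) (mv2 goR).

Definition row_prog : dprog :=
  push4 Semicolon ;;
  mv2 goL ;;
  While (fun r => isSome (r2 r))
    (Prim (fun r => Ops hold hold goL hold (pushL (r2 r)))) ;;
  mv2 goR ;; home2.

(** Every reward on tape 3 ends with one comma, so copying the row once per comma gives exactly one
    row per state. *)
Definition output_prog : dprog :=
  mv2 goR ;; home2 ;;
  push4 (Bit false) ;; push4 Hash ;;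
  mv3 goR ;; While (fun r => isSome (r3 r)) (mv3 goR) ;;
  mv3 goL ;;
  While (fun r => isSome (r3 r))
    (Prim (fun r => Ops hold hold hold goL (pushL (r3 r)))) ;;
  push4 Hash ;;
  mv3 goR ;;
  While (fun r => isSome (r3 r))
    (If (fun r => is_comma_cell (r3 r))
       row_prog (act5 hold hold hold hold hold) ;;
     mv3 goR).

Definition scan_prog : dprog :=
  (* These moves store an explicit blank cell to the left of the input and of the counter; later
     descriptions of the tapes list these end cells. *)
  act5 goL goR hold hold
    (put (Some (inr (false, false, false, (false, false))))) ;;
  mv0 goR ;;
  While (fun r => isSome (r0 r))
    (Prim (fun r =>
       match r0 r, r4 r with
       | Some (inl x), Some (inr s) =>
           Ops (pushR (sy (dfa s x).2)) (pushR unused) hold hold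
               (put (Some (inr (dfa s x).1)))
       | _, _ => idle dstate
       end)).

Definition flagA (r : reads dstate) : bool :=
  if r4 r is Some (inr (_, fA, _, _)) then fA else false.
Definition flagC (r : reads dstate) : bool :=
  if r4 r is Some (inr (_, _, fC, _)) then fC else false.

Fixpoint word_prog (w : seq symbol) : dprog :=
  if w is x :: w' then word_prog w' ;; push4 x else mv4 (put None).

Definition main_prog : dprog :=
  act5 goL hold hold hold (put None) ;;
  items_prog false ;;
  mv0 goL ;;
  items_prog true ;;
  filler_prog ;;
  output_prog.

Definition csri_prog (no yes : seq symbol) : dprog :=
  scan_prog ;;
  If flagA (word_prog no) (If flagC (word_prog yes) main_prog) ;;
  mv4 goR.

(** * The words that the program has to write *)

Definition num_word (neg : bool) (k : nat) (bs : seq bool) : seq symbol :=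
  nseq (~~ neg) (Bit true) ++ nseq (k - size bs) (Bit neg) ++
  [seq Bit (neg (+) b) | b <- bs] ++ [:: Bit true].

Definition entry_word (L : nat) (neg : bool) (k : nat) (bs : seq bool) :
    seq symbol :=
  num_word neg k bs ++ Slash :: Bit true :: nseq (L + 4) (Bit false) ++
  [:: Comma].

Definition item : Type := (bool * (seq bool * seq bool))%type.

Definition item_row (L k : nat) (x : item) : seq symbol :=
  entry_word L false k x.2.2 ++ entry_word L true k x.2.2 ++
  entry_word L false k [::] ++ entry_word L true k [::].

Definition reward_word (inv : bool) (a : seq bool) : seq symbol :=
  if inv then [:: Bit true; Slash] ++ [seq Bit c | c <- a] ++ [:: Comma]
  else [seq Bit c | c <- a] ++ [:: Slash; Bit true; Comma].

Definition item_rewards (x : item) : seq symbol :=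
  reward_word (~~ x.1) x.2.1 ++ reward_word x.1 x.2.1 ++
  reward_word x.1 x.2.1 ++ reward_word (~~ x.1) x.2.1.

Fixpoint rows_word (L : nat) (s : seq item) : seq symbol :=
  if s is x :: s' then item_row L (L - size s') x ++ rows_word L s' else [::].

Definition rewards_word (s : seq item) : seq symbol :=
  flatten [seq item_rewards x | x <- s].

Definition filler_row (n : nat) : seq symbol :=
  [:: Bit true; Slash; Bit true] ++ nseq n (Bit false) ++ [:: Comma].

Definition filler_reward : seq symbol := [:: Bit true; Slash; Bit true; Comma].

Definition full_row L s := filler_row (size s) ++ rows_word L s.
Definition full_rewards s := filler_reward ++ rewards_word s.

Definition is_comma (x : symbol) := if x is Comma then true else false.

Definition main_word (L : nat) (s : seq item) : seq symbol :=
  flatten (nseq (count is_comma (full_rewards s))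
                (full_row L s ++ [:: Semicolon])) ++
  Hash :: full_rewards s ++ [:: Hash; Bit false].

(** * Correctness of the program *)

(* The head is on the first letter of [l] in [zipL l r], and on the first letter
   of [v] in [zipR v l]. *)
Definition zipL (l r : seq cell) : tape cell := Tape (behead l) (head None l) r.
Definition zipR (v l : seq cell) : tape cell :=
  zipL (head None v :: l) (behead v).
Definition pile (w : seq symbol) : tape cell := Tape [::] None (map sy w).

Lemma op_hold (a : tape cell) : op_act hold a = a.
Proof. by case: a. Qed.

Lemma op_push x w : op_act (pushL (sy x)) (pile w) = pile (x :: w).
Proof. by []. Qed.

Lemma op_goL x l r : op_act goL (zipL (x :: l) r) = zipL l (x :: r).
Proof. by []. Qed.

Lemma op_goR x l r : op_act goR (zipL (x :: l) r) = zipR r (x :: l).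
Proof. by []. Qed.

Lemma exec_le_scan (X : Type) (st : seq X -> seq X -> dtapes)
    (b : reads dstate -> bool) f s :
  (forall u x v, s = catrev u (x :: v) -> b (reads_of (st u (x :: v))) /\
     ops_act (f (reads_of (st u (x :: v)))) (st u (x :: v)) = st (x :: u) v) ->
  ~~ b (reads_of (st (rev s) [::])) ->
  exec_le (While b (Prim f)) (2 * size s + 1) (st [::] s) (st (rev s) [::]).
Proof.
move=> Hs HF; apply: exec_le_while HF => u x v Es.
by have [bT <-] := Hs u x v Es; split=> //; apply: exec_le_prim.
Qed.

Definition used_marks (i : nat) : seq cell := nseq i used ++ [:: None].
Definition counter (k i : nat) : tape cell :=
  zipL (None :: nseq k unused ++ used_marks i) [::].

Ltac ops := rewrite /ops_act /= ?op_hold.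

Lemma home1_exec a0 a2 a3 a4 v l : all isSome v ->
  exec_le home1 (2 * size v + 1) (Tapes a0 (zipR (v ++ [:: None]) l) a2 a3 a4)
    (Tapes a0 (zipL (None :: rev v ++ l) [::]) a2 a3 a4).
Proof.
move=> vs; pose st (u v : seq cell) :=
  Tapes a0 (zipR (v ++ [:: None]) (u ++ l)) a2 a3 a4.
apply: (@exec_le_scan _ st) => // u x w Ev; split.
  by move: vs; rewrite Ev catrevE all_cat /= => /and3P[].
by rewrite /st; ops.
Qed.

Lemma home2_exec a0 a1 a3 a4 v l : all isSome v ->
  exec_le home2 (2 * size v + 1) (Tapes a0 a1 (zipR v l) a3 a4)
    (Tapes a0 a1 (zipL (None :: rev v ++ l) [::]) a3 a4).
Proof.
move=> vs; pose st (u v : seq cell) :=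
  Tapes a0 a1 (zipR v (u ++ l)) a3 a4.
apply: (@exec_le_scan _ st) => // u x w Ev; split.
  by move: vs; rewrite Ev catrevE all_cat /= => /and3P[].
by rewrite /st; ops.
Qed.

Lemma exec_le_act5 o0 o1 o2 o3 o4 a0 a1 a2 a3 a4 :
  exec_le (act5 o0 o1 o2 o3 o4) 1 (Tapes a0 a1 a2 a3 a4)
    (Tapes (op_act o0 a0) (op_act o1 a1) (op_act o2 a2) (op_act o3 a3)
           (op_act o4 a4)).
Proof. exact: exec_le_prim. Qed.

Lemma exec_le_act5E o0 o1 o2 o3 o4 a0 a1 a2 a3 a4 b0 b1 b2 b3 b4 :
  op_act o0 a0 = b0 -> op_act o1 a1 = b1 -> op_act o2 a2 = b2 ->
  op_act o3 a3 = b3 -> op_act o4 a4 = b4 ->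
  exec_le (act5 o0 o1 o2 o3 o4) 1 (Tapes a0 a1 a2 a3 a4) (Tapes b0 b1 b2 b3 b4).
Proof. by move=> <- <- <- <- <-; exact: exec_le_prim. Qed.

Ltac simp_ops := rewrite ?op_hold ?op_goL ?op_goR ?op_push.
Ltac prim := eapply exec_le_seq; [exact: exec_le_act5 | simp_ops].

Lemma used_marks_cons i : exists x l, used_marks i = x :: l /\ ~~ is_unused x.
Proof. by case: i => [|i]; [exists None, [::]|exists used, (used_marks i)]. Qed.

Lemma cat_nseq T m n (x : T) : nseq m x ++ nseq n x = nseq (m + n) x.
Proof. by rewrite nseqD. Qed.

Lemma rev_nseq T n (x : T) : rev (nseq n x) = nseq n x.
Proof.
elim: n => // n IH; rewrite [nseq _ _]/= rev_cons IH -cats1.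
by rewrite (cat_nseq n 1) addn1.
Qed.

Lemma all_some_marks k i : all isSome (nseq k unused ++ nseq i used).
Proof. by rewrite all_cat !all_nseq !orbT. Qed.

Lemma home1_counter a0 a2 a3 a4 k i v l : all isSome v ->
  rev v ++ l = nseq k unused ++ used_marks i ->
  exec_le home1 (2 * size v + 1) (Tapes a0 (zipR (v ++ [:: None]) l) a2 a3 a4)
    (Tapes a0 (counter k i) a2 a3 a4).
Proof. by move=> vs E; rewrite /counter -E; apply: home1_exec. Qed.

Lemma den_exec a0 a3 a4 w k i :
  exec_le den_prog (4 * (k + i) + 4) (Tapes a0 (counter k i) (pile w) a3 a4)
    (Tapes a0 (counter k i) (pile (nseq (k + i) (Bit false) ++ w)) a3 a4).
Proof.
set s := nseq k unused ++ nseq i used.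
have es : size s = k + i by rewrite size_cat !size_nseq.
have ss : all isSome s by exact: all_some_marks.
apply: exec_le_trans.
prim.
pose st (u v : seq cell) := Tapes a0 (zipL (v ++ [:: None]) (u ++ [:: None]))
  (pile (nseq (size u) (Bit false) ++ w)) a3 a4.
eapply exec_le_seq.
  have -> : nseq k unused ++ used_marks i = s ++ [:: None] by rewrite /s -catA.
  apply: (@exec_le_scan _ st).
    move=> u x v Ev; split.
      by move: ss; rewrite Ev catrevE all_cat => /and3P[].
    by rewrite /st; ops.
  by [].
rewrite /st /= size_rev es.
prim.
apply: home1_counter; first by rewrite all_rev.
by rewrite revK /s -catA.
by rewrite size_rev es; lia.
Qed.

Lemma pad_exec a0 a3 a4 w neg m j i :
  exec_le (pad_prog neg) (4 * (m + j) + 4)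
    (Tapes a0
       (zipL (nseq m unused ++ used_marks i) (nseq j unused ++ [:: None]))
       (pile w) a3 a4)
    (Tapes a0 (counter (m + j) i)
       (pile (nseq (~~ neg) (Bit true) ++ nseq m (Bit neg) ++ w)) a3 a4).
Proof.
have [x [l [El nU]]] := used_marks_cons i.
apply: exec_le_trans.
pose st (u v : seq unit) := Tapes a0
  (zipL (nseq (size v) unused ++ used_marks i)
        (nseq (size u) unused ++ nseq j unused ++ [:: None]))
  (pile (nseq (size u) (Bit neg) ++ w)) a3 a4.
eapply exec_le_seq.
  rewrite -{2}[m](size_nseq m tt).
  rewrite -[nseq j unused ++ _]/(nseq (size (Nil unit)) unused ++
    nseq j unused ++ _).
  apply: (@exec_le_scan _ st).
    by move=> u [] v Ev; split=> //; rewrite /st; ops.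
  by rewrite /= El.
rewrite /st /= size_rev size_nseq El.
eapply (@exec_le_seq _ _ _ 1 _ _ (Tapes a0
  (zipL (x :: l) (nseq m unused ++ nseq j unused ++ [:: None]))
  (pile (nseq (~~ neg) (Bit true) ++ nseq m (Bit neg) ++ w)) a3 a4)).
  by clear st; case: neg; apply: exec_le_act5E; rewrite ?op_hold.
prim.
rewrite catA cat_nseq.
apply: home1_counter; first by rewrite all_nseq orbT.
by rewrite rev_nseq El.
by rewrite !size_nseq; lia.
Qed.

Definition blets (bs : seq bool) : seq cell := [seq sy (Bit b) | b <- bs].

Lemma bits_exec a3 a4 w neg bs l r k i : size bs <= k ->
  let a0 := zipL (sy Semicolon :: blets (rev bs) ++ sy Comma :: l) r in
  exec_le (bits_prog neg) (4 * size bs + 4)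
    (Tapes a0 (counter k i) (pile w) a3 a4)
    (Tapes a0
       (zipL (nseq (k - size bs) unused ++ used_marks i)
        (nseq (size bs) unused ++ [:: None]))
       (pile ([seq Bit (neg (+) b) | b <- bs] ++ w)) a3 a4).
Proof.
move=> bk a0.
apply: exec_le_trans.
prim.
pose st (u v : seq bool) := Tapes
  (zipL (blets v ++ sy Comma :: l) (blets u ++ sy Semicolon :: r))
  (zipL (nseq (size v) unused ++ nseq (k - size bs) unused ++ used_marks i)
        (nseq (size u) unused ++ [:: None]))
  (pile ([seq Bit (neg (+) b) | b <- u] ++ w)) a3 a4.
eapply exec_le_seq.
  have -> : nseq k unused ++ used_marks i =
      nseq (size (rev bs)) unused ++ nseq (k - size bs) unused ++ used_marks i.
    by rewrite catA cat_nseq size_rev subnKC.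
  apply: (@exec_le_scan _ st) => //.
  by move=> u x v Ev; split=> //; rewrite /st; ops.
rewrite /st /= revK.
prim.
pose st2 (u v : seq bool) := Tapes
  (zipR (blets v ++ sy Semicolon :: r) (blets u ++ sy Comma :: l))
  (zipL (nseq (k - size bs) unused ++ used_marks i)
        (nseq (size bs) unused ++ [:: None]))
  (pile ([seq Bit (neg (+) b) | b <- bs] ++ w)) a3 a4.
apply: (@exec_le_scan _ st2) => //.
  by move=> u x v Ev; split=> //; rewrite /st2; ops.
by rewrite ?size_rev; lia.
Qed.

Lemma entry_exec a3 a4 w neg useb bs l r k i : size bs <= k ->
  let a0 := zipL (sy Semicolon :: blets (rev bs) ++ sy Comma :: l) r in
  exec_le (entry_prog neg useb) (12 * (k + i) + 24)
    (Tapes a0 (counter k i) (pile w) a3 a4)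
    (Tapes a0 (counter k i)
       (pile (entry_word (k + i) neg k (if useb then bs else [::]) ++ w))
       a3 a4).
Proof.
move=> bk a0.
apply: exec_le_trans.
do 5!prim.
eapply exec_le_seq; first exact: den_exec.
do 3!prim.
set bs' := if useb then bs else [::].
have bk' : size bs' <= k by rewrite /bs'; case: (useb).
set w' := (X in pile X).
eapply (@exec_le_seq _ _ _ (4 * k + 4) _ _ (Tapes a0
  (zipL (nseq (k - size bs') unused ++ used_marks i)
        (nseq (size bs') unused ++ [:: None]))
  (pile ([seq Bit (neg (+) b) | b <- bs'] ++ w')) a3 a4)).
  rewrite /bs'; case: (useb).
    by apply: exec_le_trans; [exact: bits_exec|lia].
  apply: exec_le_trans (_ : 1 <= _); last by lia.
  by apply: exec_le_act5E; rewrite ?op_hold //= subn0.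
have -> : entry_word (k + i) neg k bs' ++ w =
  nseq (~~ neg) (Bit true) ++ nseq (k - size bs') (Bit neg) ++
  [seq Bit (neg (+) b) | b <- bs'] ++ w'.
  rewrite /entry_word /num_word /w' -!catA /=.
  do 6!congr (_ ++ _) || congr (_ :: _).
  by rewrite nseqD addnC nseqD -!catA.
have := @pad_exec a0 a3 a4 ([seq Bit (neg (+) b) | b <- bs'] ++ w') neg
  (k - size bs') (size bs') i.
by rewrite subnK //; apply.
by rewrite ?size_rev; lia.
Qed.

Lemma reward_exec a1 a2 a4 w inv bs x l r : ~~ is_bit x ->
  let a0 := zipL (sy Comma :: blets (rev bs) ++ x :: l) r in
  exec_le (reward_prog inv) (4 * size bs + 6)
    (Tapes a0 a1 a2 (pile w) a4)
    (Tapes a0 a1 a2 (pile (reward_word inv bs ++ w)) a4).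
Proof.
move=> nx a0.
have copy w' : exec_le copy_prog (2 * size bs + 1)
   (Tapes (zipL (blets (rev bs) ++ x :: l) (sy Comma :: r)) a1 a2 (pile w') a4)
   (Tapes (zipL (x :: l) (blets bs ++ sy Comma :: r)) a1 a2
          (pile (map Bit bs ++ w')) a4).
  pose st (u v : seq bool) := Tapes
    (zipL (blets v ++ x :: l) (blets u ++ sy Comma :: r)) a1 a2
    (pile (map Bit u ++ w')) a4.
  rewrite -{1}(size_rev bs) -{3 4}(revK bs).
  apply: (@exec_le_scan _ st) => //.
  by move=> u y v Ev; split=> //; rewrite /st; ops.
apply: exec_le_trans.
prim.
eapply (@exec_le_seq _ _ _ (2 * size bs + 3) _ _ (Tapes
  (zipL (x :: l) (blets bs ++ sy Comma :: r)) a1 a2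
  (pile (reward_word inv bs ++ w)) a4)).
  rewrite /reward_word; case: inv.
    apply: exec_le_trans; first apply: exec_le_seq (copy _) _.
      prim; apply: exec_le_act5E; rewrite ?op_hold ?op_push //.
      by rewrite -!catA.
    by lia.
  apply: exec_le_trans; first do 2!prim.
    by have := copy [:: Slash, Bit true, Comma & w]; rewrite -!catA; apply.
  by rewrite ?size_rev; lia.
prim.
pose st2 (u v : seq bool) := Tapes
  (zipR (blets v ++ sy Comma :: r) (blets u ++ x :: l)) a1 a2
  (pile (reward_word inv bs ++ w)) a4.
apply: (@exec_le_scan _ st2) => //.
  by move=> u y v Ev; split=> //; rewrite /st2; ops.
by rewrite ?size_rev; lia.
Qed.

Lemma skip_bits_exec a1 a2 a3 a4 c bs x l r : ~~ is_bit x ->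
  exec_le skip_bits (2 * size bs + 2)
    (Tapes (zipL (c :: blets (rev bs) ++ x :: l) r) a1 a2 a3 a4)
    (Tapes (zipL (x :: l) (blets bs ++ c :: r)) a1 a2 a3 a4).
Proof.
move=> nx; apply: exec_le_trans.
prim.
pose st (u v : seq bool) := Tapes
  (zipL (blets v ++ x :: l) (blets u ++ c :: r)) a1 a2 a3 a4.
have -> : blets bs = blets (rev (rev bs)) by rewrite revK.
apply: (@exec_le_scan _ st) => //.
  by move=> u y v Ev; split=> //; rewrite /st; ops.
by rewrite size_rev; lia.
Qed.

Lemma count_exec a0 a2 a3 a4 k i :
  exec_le count_prog (4 * k + 9) (Tapes a0 (counter k.+1 i) a2 a3 a4)
    (Tapes a0 (counter k i.+1) a2 a3 a4).
Proof.
have [x [l [El nU]]] := used_marks_cons i.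
apply: exec_le_trans.
prim.
pose st (u v : seq unit) := Tapes a0
  (zipL (nseq (size v) unused ++ used_marks i)
        (nseq (size u) unused ++ [:: None])) a2 a3 a4.
eapply exec_le_seq.
  rewrite -{1}(size_nseq k.+1 tt).
  apply: (@exec_le_scan _ st).
    by move=> u [] v Ev; split=> //; rewrite /st; ops.
  by rewrite /= El.
rewrite /st /= size_rev /= size_nseq El.
prim; prim.
apply: (@home1_counter _ _ _ _ _ _ (used :: nseq k unused)).
  by rewrite /= all_nseq orbT.
  by rewrite rev_cons rev_nseq cat_rcons -El.
by rewrite /= !size_nseq; lia.
Qed.

Arguments entry_word : simpl never.
Arguments item_row : simpl never.
Arguments item_rewards : simpl never.
Arguments filler_row : simpl never.

(** A factor as it appears to the left of the head, where the nearest cell is listed first. *)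
Definition item_back (x : seq bool * seq bool) : seq cell :=
  sy Semicolon :: blets (rev x.2) ++ sy Comma :: blets (rev x.1).
Definition item_syms (x : seq bool * seq bool) : seq symbol :=
  map Bit x.1 ++ Comma :: map Bit x.2 ++ [:: Semicolon].

Lemma blets_map bs : map sy (map Bit bs) = blets bs.
Proof. by rewrite -map_comp. Qed.

Lemma rev_item_syms x : rev (map sy (item_syms x)) = item_back x.
Proof.
rewrite /item_syms map_cat /= map_cat !blets_map rev_cat rev_cons rev_cat /=.
by rewrite /item_back -cats1 /blets !map_rev -!catA.
Qed.

Lemma item_exec sg ab x l r w2 w3 a4 k i : ~~ is_bit x ->
  size ab.2 <= k.+1 -> size ab.1 <= k.+1 + i ->
  exec_le (item_prog sg) (100 * (k.+1 + i) + 200)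
    (Tapes (zipL (item_back ab ++ x :: l) r) (counter k.+1 i) (pile w2) (pile w3) a4)
    (Tapes (zipL (x :: l) (map sy (item_syms ab) ++ r)) (counter k i.+1)
       (pile (item_row (k.+1 + i) k.+1 (sg, ab) ++ w2))
       (pile (item_rewards (sg, ab) ++ w3)) a4).
Proof.
case: ab => a b nx bk aL; simpl in bk, aL.
have -> : item_row (k.+1 + i) k.+1 (sg, (a, b)) ++ w2 =
  entry_word (k.+1 + i) false k.+1 b ++ entry_word (k.+1 + i) true k.+1 b ++
  entry_word (k.+1 + i) false k.+1 [::] ++
  entry_word (k.+1 + i) true k.+1 [::] ++ w2 by rewrite /item_row -!catA.
have -> : item_rewards (sg, (a, b)) ++ w3 =
  reward_word (~~ sg) a ++ reward_word sg a ++ reward_word sg a ++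
  reward_word (~~ sg) a ++ w3 by rewrite /item_rewards -!catA.
have -> : map sy (item_syms (a, b)) ++ r =
  blets a ++ sy Comma :: blets b ++ sy Semicolon :: r.
  by rewrite /item_syms map_cat /= map_cat !blets_map -!catA /= -!catA.
rewrite /item_back cat_cons -catA cat_cons.
apply: exec_le_trans.
do 4 (eapply exec_le_seq; first by apply: entry_exec; exact: bk).
eapply exec_le_seq; first exact: skip_bits_exec.
do 4 (eapply exec_le_seq; first by apply: reward_exec).
eapply exec_le_seq; first exact: skip_bits_exec.
exact: count_exec.
by rewrite /=; lia.
Qed.

(** The leftward scan over the bits of a base has to stop: the preceding cell is the semicolon of
    another factor or the delimiter [x]. *)
Lemma flatten_back v x l : ~~ is_bit x ->
  exists y m, flatten (map item_back v) ++ x :: l = y :: m /\ ~~ is_bit y.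
Proof.
by case: v => [|a v] nx; [exists x, l|exists (sy Semicolon); eexists; split=> //=].
Qed.

Lemma items_exec sg s base L x l r a4 :
  ~~ is_bit x -> ~~ is_semi x ->
  (forall s1 ab s2, s = s1 ++ ab :: s2 ->
     size ab.1 <= L /\ size ab.2 + size s2 + size base < L) ->
  exec_le (items_prog sg) ((100 * L + 201) * size s + 1)
    (Tapes (zipL (flatten (map item_back (rev s)) ++ x :: l) r)
       (counter (L - size base) (size base)) (pile (rows_word L base))
       (pile (rewards_word base)) a4)
    (Tapes (zipL (x :: l) (map sy (flatten (map item_syms s)) ++ r))
       (counter (L - size s - size base) (size s + size base))
       (pile (rows_word L (map (pair sg) s ++ base)))
       (pile (rewards_word (map (pair sg) s ++ base))) a4).
Proof.
move=> nx ns Hs.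
pose st (u v : seq (seq bool * seq bool)) := Tapes
  (zipL (flatten (map item_back v) ++ x :: l)
        (map sy (flatten (map item_syms u)) ++ r))
  (counter (L - size u - size base) (size u + size base))
  (pile (rows_word L (map (pair sg) u ++ base)))
  (pile (rewards_word (map (pair sg) u ++ base))) a4.
apply: exec_le_trans.
  have := @exec_le_while _ _ st (fun r => is_semi (r0 r)) (item_prog sg)
     (100 * L + 200) (rev s) _ _.
  rewrite revK [st [::] _]/st /= subn0 add0n; apply=> //.
  move=> u ab v Ev; split=> //.
  (* The factors are met from the last to the first, so the loop runs over [rev s] and the processed
     part [u] is a suffix of [s]. *)
  have Es : s = rev v ++ ab :: u.
    by rewrite -(revK s) Ev catrevE rev_cat revK rev_cons cat_rcons.
  have [aL bL] := Hs _ _ _ Es.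
  have [y [m [Ey ny]]] := @flatten_back v x l nx.
  set k := L - (size u).+1 - size base.
  have EL : L = k.+1 + (size u + size base) by rewrite /k; lia.
  have -> : st u (ab :: v) = Tapes (zipL (item_back ab ++ y :: m)
      (map sy (flatten (map item_syms u)) ++ r))
      (counter k.+1 (size u + size base))
      (pile (rows_word L (map (pair sg) u ++ base)))
      (pile (rewards_word (map (pair sg) u ++ base))) a4.
    by rewrite /st -Ey catA; congr (Tapes _ (counter _ _) _ _ _); rewrite /k; lia.
  have -> : st (ab :: u) v = Tapes (zipL (y :: m)
      (map sy (item_syms ab) ++ map sy (flatten (map item_syms u)) ++ r))
      (counter k (size u + size base).+1)
      (pile (item_row L k.+1 (sg, ab) ++ rows_word L (map (pair sg) u ++ base)))
      (pile (item_rewards (sg, ab) ++ rewards_word (map (pair sg) u ++ base)))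
      a4.
    rewrite /st -Ey catA -map_cat; congr (Tapes _ _ (pile (item_row _ _ _ ++ _)) _ _).
    by rewrite size_cat size_map EL addnK.
  have := @item_exec sg ab y m (map sy (flatten (map item_syms u)) ++ r)
    (rows_word L (map (pair sg) u ++ base))
    (rewards_word (map (pair sg) u ++ base)) a4 k (size u + size base) ny _ _.
  by rewrite -EL; apply=> //; lia.
by rewrite size_rev; lia.
Qed.

Lemma filler_exec a0 a4 w2 w3 k i : exists T1,
  exec_le filler_prog (2 * k + 2 * i + 20)
    (Tapes a0 (counter k i) (pile w2) (pile w3) a4)
    (Tapes a0 T1 (pile (filler_row i ++ w2)) (pile (filler_reward ++ w3)) a4).
Proof.
have [x [l [El nU]]] := used_marks_cons i.
eexists; apply: exec_le_trans.
do 2!prim.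
pose st (u v : seq unit) := Tapes a0
  (zipL (nseq (size v) unused ++ used_marks i) (nseq (size u) unused ++ [:: None]))
  (pile (Comma :: w2)) (pile w3) a4.
eapply exec_le_seq.
  have -> : nseq k unused = nseq (size (nseq k tt)) unused by rewrite size_nseq.
  apply: (@exec_le_scan _ st).
    by move=> u [] v Ev; split=> //; rewrite /st; ops.
  by rewrite /= El.
rewrite /st /=.
set r := nseq (size (rev _)) unused ++ _.
pose st2 (u v : seq unit) := Tapes a0
  (zipL (used_marks (size v)) (nseq (size u) used ++ r))
  (pile (nseq (size u) (Bit false) ++ Comma :: w2)) (pile w3) a4.
eapply exec_le_seq.
  have -> : used_marks i = used_marks (size (nseq i tt)) by rewrite size_nseq.
  apply: (@exec_le_scan _ st2) => //.
  by move=> u [] v Ev; split=> //; rewrite /st2; ops.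
rewrite /st2.
do 6!prim.
apply: exec_le_act5E; rewrite ?op_hold //.
  by rewrite size_rev size_nseq /filler_row -!catA.
by rewrite /= !size_nseq; lia.
Qed.

(** In contrast to [home2_exec], the blank at the right end is now an explicit cell, left behind by
    the first pass over the row. *)
Lemma home2_right a0 a1 a3 a4 row :
  exec_le home2 (2 * size row + 1)
    (Tapes a0 a1 (zipR (map sy row ++ [:: None]) [:: None]) a3 a4)
    (Tapes a0 a1 (zipL (None :: rev (map sy row) ++ [:: None]) [::]) a3 a4).
Proof.
rewrite -map_rev.
pose st (u v : seq symbol) := Tapes a0 a1
  (zipR (map sy v ++ [:: None]) (map sy u ++ [:: None])) a3 a4.
apply: (@exec_le_scan _ st) => //.
by move=> u x v Ev; split=> //; rewrite /st; ops.
Qed.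

Lemma row_exec a0 a1 a3 row w :
  let a2 := zipL (None :: rev (map sy row) ++ [:: None]) [::] in
  exec_le row_prog (4 * size row + 5) (Tapes a0 a1 a2 a3 (pile w))
    (Tapes a0 a1 a2 a3 (pile (row ++ Semicolon :: w))).
Proof.
apply: exec_le_trans.
do 2!prim.
pose st (u v : seq symbol) := Tapes a0 a1
  (zipL (map sy v ++ [:: None]) (map sy u ++ [:: None])) a3
  (pile (u ++ Semicolon :: w)).
eapply exec_le_seq.
  rewrite -map_rev.
  apply: (@exec_le_scan _ st) => //.
  by move=> u x v Ev; split=> //; rewrite /st; ops.
rewrite /st /= revK.
prim.
apply: home2_right.
by rewrite size_rev; lia.
Qed.

Lemma output_exec a0 a1 row rew : exists T2 T3,
  exec_le output_prog ((4 * size row + 20) * (size rew + 1) + 20)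
    (Tapes a0 a1 (pile row) (pile rew) (pile [::]))
    (Tapes a0 a1 T2 T3
       (pile (flatten (nseq (count is_comma rew) (row ++ [:: Semicolon])) ++
              Hash :: rew ++ [:: Hash; Bit false]))).
Proof.
set H2 := zipL (None :: rev (map sy row) ++ [:: None]) [::].
exists H2; eexists; apply: exec_le_trans.
prim.
eapply exec_le_seq.
  by apply: home2_exec; rewrite all_map; elim: (row).
rewrite -/H2.
do 3!prim.
pose st3 (u v : seq symbol) := Tapes a0 a1 H2
  (zipR (map sy v) (map sy u ++ [:: None])) (pile [:: Hash; Bit false]).
eapply exec_le_seq.
  apply: (@exec_le_scan _ st3 _ _ rew) => //.
  by move=> u x v Ev; split=> //; rewrite /st3; ops.
rewrite /st3 /=.
prim.
pose st4 (u v : seq symbol) := Tapes a0 a1 H2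
  (zipL (map sy v ++ [:: None]) (map sy u ++ [:: None]))
  (pile (u ++ [:: Hash; Bit false])).
eapply exec_le_seq.
  apply: (@exec_le_scan _ st4) => //.
  by move=> u x v Ev; split=> //; rewrite /st4; ops.
rewrite /st4 /= revK.
do 2!prim.
pose st5 (u v : seq symbol) := Tapes a0 a1 H2
  (zipR (map sy v ++ [:: None]) (map sy u ++ [:: None]))
  (pile (flatten (nseq (count is_comma u) (row ++ [:: Semicolon])) ++
              Hash :: rew ++ [:: Hash; Bit false])).
have -> : count is_comma rew = count is_comma (rev rew) by rewrite count_rev.
apply: (@exec_le_while _ _ st5 _ _ (4 * size row + 10)) => //.
  move=> u x v Ev; split=> //.
  apply: exec_le_trans (_ : (4 * size row + 5).+1 + 1 <= _); last by lia.
  apply: (@exec_le_seq _ _ _ _ _ _ (Tapes a0 a1 H2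
    (zipR (map sy (x :: v) ++ [:: None]) (map sy u ++ [:: None]))
    (pile (flatten (nseq (count is_comma (x :: u)) (row ++ [:: Semicolon])) ++
              Hash :: rew ++ [:: Hash; Bit false]))));
    last by apply: exec_le_act5E; rewrite ?op_hold.
  case cx: (is_comma x).
    apply: exec_le_ifT; first by case: (x) cx.
    rewrite [count _ (x :: u)]/= cx add1n [nseq _.+1 _]/= [flatten (_ :: _)]/= -!catA.
    exact: row_exec.
  apply: exec_le_ifF; first by case: (x) cx.
  rewrite [count _ (x :: u)]/= cx add0n.
  apply: exec_le_trans (_ : 1 <= _); last by lia.
  by apply: exec_le_act5E; rewrite ?op_hold.
by rewrite ?size_rev ?size_map; lia.
Qed.

(** * The scan, the length of the output, and the complete program *)

Fixpoint dfa_run (s : dstate) (w : seq symbol) : dstate * seq symbol :=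
  if w is x :: w' then
    let r := dfa_run (dfa s x).1 w' in (r.1, (dfa s x).2 :: r.2)
  else (s, [::]).

Definition dstate0 : dstate := (false, false, false, (false, false)).

Definition state_tape (s : dstate) : tape cell := Tape [::] (Some (inr s)) [::].

Lemma scan_exec x w s w' : dfa_run dstate0 (x :: w) = (s, w') ->
  exec_le scan_prog (2 * size w + 5) (init_tapes dstate (x :: w))
    (Tapes (zipL (None :: rev (map sy w') ++ [:: None]) [::])
       (counter (size w).+1 0) (pile [::]) (pile [::]) (state_tape s)).
Proof.
move=> E; apply: exec_le_trans.
have -> : init_tapes dstate (x :: w) =
  Tapes (zipR (map sy (x :: w)) [::]) (pile [::]) (pile [::]) (pile [::]) (pile [::]) by [].
prim.
prim.
set lp := While _ _.
suff H u v l l1 s1 s2 : dfa_run s1 u = (s2, v) ->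
   exec_le lp (2 * size u + 1)
     (Tapes (zipR (map sy u) l) (Tape l1 None [::]) (pile [::]) (pile [::])
            (state_tape s1))
     (Tapes (zipL (None :: rev (map sy v) ++ l) [::])
            (Tape (nseq (size u) unused ++ l1) None [::]) (pile [::]) (pile [::])
            (state_tape s2)).
  by have := H _ _ [:: None] [:: None] _ _ E; apply.
elim: u v l l1 s1 => [|y u IH] v l l1 s1.
  by case=> <- <-; exists 1 => //; apply: ExecWhileF.
rewrite /=; case E2: dfa_run => [s' v'] [es <-]; rewrite {}es in E2.
have [m lm Hw] := IH v' (sy (dfa s1 y).2 :: l) (unused :: l1) _ E2.
exists (2 + m); first by lia.
rewrite rev_cons cat_rcons.
have -> : unused :: nseq (size u) unused ++ l1 =
    nseq (size u) unused ++ unused :: l1.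
  by rewrite -cat1s catA (cat_nseq 1) addnC -cat_nseq -catA.
apply: ExecWhileT Hw => //.
exact: ExecPrim.
by rewrite /=; lia.
Qed.

Definition fits (L : nat) (its : seq item) : Prop :=
  forall s1 x s2, its = s1 ++ x :: s2 ->
    size x.2.1 <= L /\ size x.2.2 + size s2 < L.

Lemma rev_items s :
  rev (map sy (flatten (map item_syms s))) = flatten (map item_back (rev s)).
Proof.
elim: s => // x s IH.
by rewrite /= map_cat rev_cat IH rev_item_syms rev_cons map_rcons flatten_rcons.
Qed.

Lemma size_entry L neg k bs : size bs <= k ->
  size (entry_word L neg k bs) <= k + L + 9.
Proof.
rewrite /entry_word /num_word !(size_cat, size_nseq, size_map) /=.
rewrite !(size_cat, size_nseq) /=.
by case: neg => /=; lia.
Qed.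

Lemma fits_cons L x s : fits L (x :: s) ->
  [/\ size x.2.1 <= L, size x.2.2 + size s < L & fits L s].
Proof.
move=> H; have [aL bL] := H [::] x s erefl; split=> // s1 y s2 E.
by apply: (H (x :: s1)); rewrite E.
Qed.

Lemma size_rows L s : fits L s -> size (rows_word L s) <= size s * (8 * L + 36).
Proof.
elim: s => // x s IH /fits_cons[_ bL /IH{}IH].
have -> : rows_word L (x :: s) = item_row L (L - size s) x ++ rows_word L s by [].
rewrite size_cat [size (x :: s)]/= mulSn leq_add //.
have bk : size x.2.2 <= L - size s by lia.
rewrite /item_row 3!(size_cat (entry_word _ _ _ _)).
have := @size_entry L false _ _ bk; have := @size_entry L true _ _ bk.
have := @size_entry L false (L - size s) [::] isT.
have := @size_entry L true (L - size s) [::] isT.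
by lia.
Qed.

Lemma size_rewards L s : fits L s ->
  size (rewards_word s) <= size s * (4 * L + 12).
Proof.
elim: s => // x s IH /fits_cons[aL _ /IH{}IH].
have -> : rewards_word (x :: s) = item_rewards x ++ rewards_word s by [].
rewrite size_cat [size (x :: s)]/= mulSn leq_add //.
have H b : size (reward_word b x.2.1) = size x.2.1 + 3.
  by case: b; rewrite /reward_word !size_cat size_map /=; lia.
by rewrite /item_rewards 3!(size_cat (reward_word _ _)) !H; lia.
Qed.

(** The first term is for the two passes over the factors. The product is for the output: both the
    row and the list of rewards have length quadratic in [L], which makes the bound quartic. *)
Definition time_bound (L : nat) : nat :=
  2 * ((100 * L + 201) * L) +
  (4 * (L + 5 + L * (8 * L + 36)) + 20) * (L * (4 * L + 12) + 5) + 10 * L + 200.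

(** The subtracted [8 * L + 100] steps are set aside for the scan, the tests of the flags and the
    final move. *)
Lemma main_exec sA sC L c :
  let its : seq item := map (pair true) sA ++ map (pair false) sC in
  let w := flatten (map item_syms sA) ++ Hash :: flatten (map item_syms sC) in
  fits L its -> size its <= L -> exists T0 T1 T2 T3,
  exec_le main_prog (time_bound L - 8 * L - 100)
    (Tapes (zipL (None :: rev (map sy w) ++ [:: None]) [::])
       (counter L 0) (pile [::]) (pile [::]) (Tape [::] c [::]))
    (Tapes T0 T1 T2 T3 (pile (main_word L its))).
Proof.
move=> its w fL sL.
have [T1 filler] := @filler_exec
   (zipL [:: None] (map sy w ++ [:: None])) (pile [::])
   (rows_word L its) (rewards_word its) (L - size its) (size its).
have [T2 [T3 output]] := @output_exec
   (zipL [:: None] (map sy w ++ [:: None])) T1 (full_row L its) (full_rewards its).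
set a0 := zipL [:: None] (map sy w ++ [:: None]) in filler output.
exists a0, T1, T2, T3.
have szs : size its = size sA + size sC by rewrite size_cat !size_map.
apply: exec_le_trans.
prim.
rewrite {1}/w map_cat /= rev_cat rev_cons !rev_items cat_rcons -catA /=.
eapply exec_le_seq.
  have := @items_exec false sC [::] L (sy Hash)
    (flatten (map item_back (rev sA)) ++ [:: None]) [:: None] (pile [::]) isT isT.
  rewrite subn0; apply => s1 x s2 E.
  have := fL (map (pair true) sA ++ map (pair false) s1) (false, x)
             (map (pair false) s2).
  by rewrite size_map addn0; apply; rewrite /its E map_cat -catA.
prim.
eapply exec_le_seq.
  have := @items_exec true sA (map (pair false) sC) L None [::]
    (sy Hash :: map sy (flatten (map item_syms sC)) ++ [:: None]) (pile [::]) isT isT.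
  rewrite size_map subn0 !cats0 !addn0; apply => s1 x s2 E.
  have := fL (map (pair true) s1) (true, x)
             (map (pair true) s2 ++ map (pair false) sC).
  by rewrite size_cat !size_map -addnA; apply; rewrite /its E map_cat -catA.
eapply exec_le_seq.
  have -> : map sy (flatten (map item_syms sA)) ++ sy Hash ::
      map sy (flatten (map item_syms sC)) ++ [:: None] = map sy w ++ [:: None].
    by rewrite /w map_cat -catA.
  rewrite -/a0 -/its -subnDA -szs; exact: filler.
exact: output.
have Hrow : size (full_row L its) <= L + 5 + L * (8 * L + 36).
  have := size_rows fL; rewrite /full_row size_cat /filler_row /= size_cat size_nseq /=.
  have : size its * (8 * L + 36) <= L * (8 * L + 36) by rewrite leq_mul2r sL orbT.
  by lia.
have Hrew : size (full_rewards its) <= L * (4 * L + 12) + 4.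
  have := size_rewards fL; rewrite /full_rewards size_cat /=.
  have : size its * (4 * L + 12) <= L * (4 * L + 12) by rewrite leq_mul2r sL orbT.
  by lia.
have HH : (4 * size (full_row L its) + 20) * (size (full_rewards its) + 1) <=
  (4 * (L + 5 + L * (8 * L + 36)) + 20) * (L * (4 * L + 12) + 5).
  by apply: leq_mul; lia.
have HA : (100 * L + 201) * size sA <= (100 * L + 201) * L by rewrite leq_mul2l; lia.
have HC : (100 * L + 201) * size sC <= (100 * L + 201) * L by rewrite leq_mul2l; lia.
rewrite /time_bound.
set X := (_ * (L * (4 * L + 12) + 5)) in HH *.
set Y := (100 * L + 201) * L in HA HC *.
by lia.
Qed.

Lemma word_exec a0 a1 a2 a3 c w :
  exec_le (word_prog w) (size w + 1) (Tapes a0 a1 a2 a3 (Tape [::] c [::]))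
    (Tapes a0 a1 a2 a3 (pile w)).
Proof.
elim: w => [|x w IH]; first by apply: exec_le_act5E; rewrite ?op_hold.
apply: exec_le_trans.
  eapply exec_le_seq; first exact: IH.
  by apply: exec_le_act5E; rewrite ?op_hold.
by rewrite /= addn1.
Qed.

Lemma csri_prog_computes no yes x w sA sC sec fA fC pos w' :
  dfa_run dstate0 (x :: w) = (sec, fA, fC, pos, w') ->
  let its : seq item := map (pair true) sA ++ map (pair false) sC in
  let L := (size w).+1 in
  (w' = flatten (map item_syms sA) ++ Hash :: flatten (map item_syms sC)) ->
  fits L its -> size its <= L ->
  @tm_computes_in symbol (prog_tm (csri_prog no yes))
     (time_bound L + size no + size yes) (x :: w)
     (if fA then no else if fC then yes else main_word L its).
Proof.
move=> E its L Ew' fL sL.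
have scan := scan_exec E.
set v := if fA then _ else _.
have [T0 [T1 [T2 [T3 H]]]] : exists T0 T1 T2 T3,
   exec_le (csri_prog no yes) (time_bound L + size no + size yes)
    (init_tapes dstate (x :: w))
    (Tapes T0 T1 T2 T3 (zipR (map sy v) [:: None])).
  have fin a0 a1 a2 a3 u : exec_le (mv4 goR) 1
      (Tapes a0 a1 a2 a3 (pile u)) (Tapes a0 a1 a2 a3 (zipR (map sy u) [:: None])).
    by apply: exec_le_act5E; rewrite ?op_hold.
  have [m [T0 [T1 [T2 [T3 [Hm Hmid]]]]]] : exists m T0 T1 T2 T3,
    (m <= time_bound L + size no + size yes - 2 * L - 10) /\
    exec_le (If flagA (word_prog no) (If flagC (word_prog yes) main_prog)) m
      (Tapes (zipL (None :: rev (map sy w') ++ [:: None]) [::])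
       (counter L 0) (pile [::]) (pile [::]) (state_tape (sec, fA, fC, pos)))
      (Tapes T0 T1 T2 T3 (pile v)).
    rewrite /v; case: fA E scan v => E scan v.
      do 5!eexists; split; last first.
        by apply: exec_le_ifT => //; exact: word_exec.
      by rewrite /time_bound; lia.
    case: fC E scan v => E scan v.
      do 5!eexists; split; last first.
        by apply: exec_le_ifF => //; apply: exec_le_ifT => //; exact: word_exec.
      by rewrite /time_bound; lia.
    have [T0 [T1 [T2 [T3 Hmain]]]] := @main_exec sA sC L
      (Some (inr (sec, false, false, pos))) fL sL.
    rewrite -Ew' in Hmain.
    do 5!eexists; split; last first.
      by apply: exec_le_ifF => //; apply: exec_le_ifF => //; exact: Hmain.
    by rewrite /time_bound; lia.
  exists T0, T1, T2, T3; apply: exec_le_trans.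
    eapply exec_le_seq; first exact: scan.
    eapply exec_le_seq; first exact: Hmid.
    exact: fin.
  have : 100 + 10 * L <= time_bound L by rewrite /time_bound; lia.
  clear -Hm; move: Hm; rewrite -/L; have : (size w).+1 = L by [].
  by clearbody L; lia.
have -> : v = oword (tcur (t4 (Tapes T0 T1 T2 T3 (zipR (map sy v) [:: None]))) ::
    tright (t4 (Tapes T0 T1 T2 T3 (zipR (map sy v) [:: None])))).
  by rewrite /=; elim: (v) => //= y [|z u] //= <-.
exact: prog_tm_computes.
Qed.

(** * Binary numerals *)

Definition bits (n : nat) : seq bool :=
  [seq odd (n %/ 2 ^ i) | i <- rev (iota 0 (trunc_log 2 n).+1)].

Definition bval (s : seq bool) : nat := foldl (fun n (b : bool) => n.*2 + b) 0 s.

Lemma enc_nat_bits n : enc_nat n = map Bit (bits n).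
Proof. by rewrite /enc_nat /bits -map_comp. Qed.

Lemma bits_double n (b : bool) : 0 < n -> bits (n.*2 + b) = rcons (bits n) b.
Proof.
move=> n0; rewrite /bits.
have -> : trunc_log 2 (n.*2 + b) = (trunc_log 2 n).+1.
  rewrite trunc_log2S; last by lia.
  by rewrite addnC half_bit_double.
set t := (trunc_log 2 n).+1.
rewrite -[t.+1]/(1 + t) iotaD rev_cat map_cat add0n cats1.
congr rcons; last by rewrite /= expn0 divn1 oddD odd_double oddb.
rewrite -[1]/(1 + 0) iotaDl -map_rev -map_comp; apply: eq_map => i /=.
by rewrite add1n expnS divnMA divn2 addnC half_bit_double.
Qed.

Lemma bits_cons n : 0 < n -> exists s, bits n = true :: s.
Proof.
elim/ltn_ind: n => n IH n0; case: (posnP n./2) => [n2|n2].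
  have -> : n = 1 by lia.
  by exists [::].
have [|//|s Es] := IH n./2 _ _; first by lia.
by exists (rcons s (odd n)); rewrite -{1}(odd_double_half n) addnC bits_double // Es.
Qed.

Lemma size_bits_gt0 n : 0 < size (bits n).
Proof. by rewrite size_map size_rev size_iota. Qed.

Lemma bval_rcons s b : bval (rcons s b) = (bval s).*2 + b.
Proof. by rewrite /bval -cats1 foldl_cat. Qed.

Lemma bval_bits n : bval (bits n) = n.
Proof.
elim/ltn_ind: n => n IH; case: (posnP n./2) => [n2|n2].
  have : n = 0 \/ n = 1 by lia.
  by case=> ->.
rewrite -{1}(odd_double_half n) addnC bits_double // bval_rcons IH; last by lia.
by rewrite addnC odd_double_half.
Qed.

Lemma bval_cat s u : bval (s ++ u) = bval s * 2 ^ size u + bval u.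
Proof.
elim/last_ind: u => [|u b IH]; first by rewrite cats0 muln1 addn0.
by rewrite -rcons_cat !bval_rcons IH size_rcons expnS; lia.
Qed.

Lemma bval_nseq_false k : bval (nseq k false) = 0.
Proof. by elim: k => // k IH. Qed.

Lemma bval_lt s : bval s < 2 ^ size s.
Proof.
elim/last_ind: s => // s b IH.
by rewrite bval_rcons size_rcons expnS; case: b; lia.
Qed.

Lemma bval_negb s : bval (map negb s) + bval s + 1 = 2 ^ size s.
Proof.
elim/last_ind: s => // s b IH.
by rewrite map_rcons !bval_rcons size_rcons expnS -IH; case: b => /=; lia.
Qed.

Lemma bits_bval s : bits (bval (true :: s)) = true :: s.
Proof.
elim/last_ind: s => // s b IH.
rewrite -rcons_cons bval_rcons bits_double ?IH //.
by rewrite -cat1s bval_cat addn_gt0 muln_gt0 expn_gt0.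
Qed.

Definition numer (neg : bool) (k b : nat) : nat :=
  if neg then 2 ^ k.+1 - b.*2.+1 else 2 ^ k.+1 + b.*2.+1.

(** In binary, [2 ^ k.+1 + (2 b + 1)] is a 1, then [b] in [k] bits, then a 1. Complementing the [k]
    bits turns [b] into [2 ^ k - 1 - b], and appending a 1 gives [2 ^ k.+1 - (2 b + 1)]. *)
Lemma num_wordE neg k bs : size bs < k ->
  num_word neg k bs = enc_nat (numer neg k (bval bs)).
Proof.
move=> bk; set s := nseq (k - size bs) false ++ bs.
have szs : size s = k by rewrite size_cat size_nseq; lia.
have vs : bval s = bval bs by rewrite bval_cat bval_nseq_false.
have Es : (if neg then map negb s ++ [:: true] else true :: s ++ [:: true]) =
          bits (numer neg k (bval bs)).
  rewrite /numer; case: neg.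
    have -> : 2 ^ k.+1 - (bval bs).*2.+1 = bval (map negb s ++ [:: true]).
      rewrite bval_cat -vs expnS -szs -(bval_negb s) /= /bval /=.
      by rewrite -!/(bval _); lia.
    (* The strict inequality leaves at least one padding zero; its complement is the leading 1 of a
       numeral without leading zeros. *)
    have -> : map negb s = true :: map negb (nseq (k - size bs).-1 false ++ bs).
      rewrite /s; case: (k - size bs) (subn_gt0 (size bs) k); rewrite bk //.
    by rewrite cat_cons bits_bval.
  rewrite -bits_bval; congr bits.
  rewrite -cat1s catA bval_cat /= -cat1s bval_cat szs vs /=.
  by rewrite expn1 expnS /bval /= -/(bval _); lia.
rewrite enc_nat_bits -Es /num_word /s; clear Es; case: neg => /=.
  by rewrite !map_cat -!map_comp /= !map_nseq -catA.
by rewrite !map_cat /= !map_nseq -catA; congr (_ :: _ ++ _ ++ _); apply: eq_map => -[].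
Qed.

Lemma enc_nat_exp2 k : enc_nat (2 ^ k) = Bit true :: nseq k (Bit false).
Proof.
rewrite enc_nat_bits.
have -> : 2 ^ k = bval (true :: nseq k false).
  by rewrite -cat1s bval_cat bval_nseq_false size_nseq mul1n addn0.
by rewrite bits_bval /= map_nseq.
Qed.

Lemma size_bits_ltP n : n < 2 ^ size (bits n).
Proof. by rewrite -{1}(bval_bits n) bval_lt. Qed.

(** * The input automaton *)

Lemma dfa_run_cat s w1 w2 : dfa_run s (w1 ++ w2) =
  ((dfa_run (dfa_run s w1).1 w2).1,
   (dfa_run s w1).2 ++ (dfa_run (dfa_run s w1).1 w2).2).
Proof.
elim: w1 s => [|x w1 IH] s; first by rewrite /=; case: dfa_run.
by rewrite /= !IH.
Qed.

Definition zero_power (ab : nat * nat) : bool := (ab.1 == 0) && (0 < ab.2).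
(** This makes every reward positive. It keeps the value of [0 ^ 0], and it replaces a single
    letter, so the length of the input does not change. *)
Definition fix_base (ab : nat * nat) : nat * nat := (maxn ab.1 1, ab.2).
Definition pair_bits (ab : nat * nat) : seq bool * seq bool :=
  (bits ab.1, bits ab.2).
Definition enc_pair (ab : nat * nat) : seq symbol :=
  enc_nat ab.1 ++ Comma :: enc_nat ab.2 ++ [:: Semicolon].

Lemma enc_pair_syms ab : enc_pair ab = item_syms (pair_bits ab).
Proof. by rewrite /enc_pair /item_syms !enc_nat_bits. Qed.

Lemma dfa_bits sec fA fC s : dfa_run (sec, fA, fC, (true, true)) (map Bit s) =
  ((sec, fA, fC, (true, true)), map Bit s).
Proof. by elim: s => //= b s ->. Qed.

Lemma dfa_pair sec fA fC ab :
  dfa_run (sec, fA, fC, (false, false)) (enc_pair ab) =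
  ((sec, fA || ~~ sec && zero_power ab, fC || sec && zero_power ab,
    (false, false)), enc_pair (fix_base ab)).
Proof.
case: ab => a b; rewrite /zero_power /enc_pair /fix_base /=.
rewrite !enc_nat_bits.
case: (posnP a) => [->|a0].
  rewrite [bits 0]/= [bits (maxn 0 1)]/= /=.
  case: (posnP b) => [->|b0]; first by rewrite /= !andbF !orbF.
  have [s Es] := bits_cons b0; rewrite Es /= dfa_run_cat dfa_bits /=.
  by rewrite !andbT.
have -> : maxn a 1 = a by lia.
have [s Es] := bits_cons a0; rewrite Es /=.
rewrite dfa_run_cat dfa_bits /= dfa_run_cat dfa_bits /=.
by rewrite !andbF !orbF.
Qed.

Lemma dfa_powers sec fA fC s :
  dfa_run (sec, fA, fC, (false, false)) (flatten (map enc_pair s)) =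
  ((sec, fA || ~~ sec && has zero_power s, fC || sec && has zero_power s,
    (false, false)), flatten (map enc_pair (map fix_base s))).
Proof.
elim: s fA fC => [|ab s IH] fA fC; first by rewrite /= !andbF !orbF.
rewrite /= dfa_run_cat dfa_pair IH /=.
by congr (_, _, _, _, _); rewrite -orbA -andb_orr.
Qed.

Lemma dfa_csri x : dfa_run dstate0 (enc_csri x) =
  ((true, has zero_power x.1, has zero_power x.2, (false, false)),
   enc_csri (map fix_base x.1, map fix_base x.2)).
Proof.
by rewrite /enc_csri /enc_powers dfa_run_cat !dfa_powers /= !dfa_powers /= orbF.
Qed.

Import Order.TTheory GRing.Theory Num.Theory.
Local Open Scope ring_scope.

(** * Chains with independent identically distributed steps *)

(** The chain is given by its states as pairs of a probability and a reward. Positive probabilities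
    allow every transition in one step, whence strong connectedness. *)
Definition prob_rewards (e : seq (rat * rat)) : bool :=
  [&& (0 < size e)%N, all (fun pr => (0 < pr.1) && (0 < pr.2)) e &
      \sum_(pr <- e) pr.1 == 1].

Section IidInstance.
Variables (e : seq (rat * rat)) (He : prob_rewards e).

Definition iid_trans (_ t : 'I_(size e)) : rat := (nth (0, 0) e t).1.
Definition iid_reward (t : 'I_(size e)) : rat := (nth (0, 0) e t).2.
Definition iid_start : 'I_(size e) := Ordinal (andP He).1.

Lemma iid_gt0 (t : 'I_(size e)) :
  (0 < (nth (0, 0) e t).1) && (0 < (nth (0, 0) e t).2).
Proof. by case/and3P: He => _ /allP H _; apply/H/mem_nth. Qed.

Lemma iid_markov : is_markov_chain iid_trans.
Proof.
split=> [s t|s]; first by case/andP: (iid_gt0 t) => /ltW.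
case/and3P: He => _ _ /eqP <-.
by rewrite (big_nth (0, 0)) big_mkord.
Qed.

Lemma iid_connected : strongly_connected iid_trans.
Proof. by move=> s t; apply: connect1; case/andP: (iid_gt0 t). Qed.

Lemma iid_reward_gt0 s : 0 < iid_reward s.
Proof. by case/andP: (iid_gt0 s). Qed.

Definition iid_instance : log_mp_instance :=
  LogMPInstance iid_start iid_markov iid_connected iid_reward_gt0.

Definition enc_rats (s : seq rat) : seq symbol :=
  flatten [seq enc_rat q ++ [:: Comma] | q <- s].

Lemma enc_iid_instance :
  enc_log_mp iid_instance =
  flatten (nseq (size e) (enc_rats (map fst e) ++ [:: Semicolon])) ++
  Hash :: enc_rats (map snd e) ++ [:: Hash; Bit false].
Proof.
have E (T : Type) (f : rat * rat -> T) :
    [seq f (nth (0, 0) e (nat_of_ord i)) | i <- enum 'I_(size e)] = map f e.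
  rewrite -[in RHS](mkseq_nth (0, 0) e) /mkseq -val_enum_ord.
  by elim: (enum _) => //= i s ->.
rewrite /enc_log_mp /=; congr (_ ++ _).
  congr flatten.
  rewrite -[size e in RHS]size_enum_ord.
  set row := enc_rats (map fst e) ++ [:: Semicolon].
  have -> : nseq (size (enum 'I_(size e))) row =
      [seq row | _ <- enum 'I_(size e)].
    by elim: (enum _) => //= _ s ->.
  apply: eq_map => s; congr (_ ++ _).
  by rewrite /enc_rats -map_comp -(E _ (fun pr => enc_rat pr.1 ++ [:: Comma])).
congr (Hash :: _); congr (_ ++ _).
by rewrite /enc_rats -map_comp -(E _ (fun pr => enc_rat pr.2 ++ [:: Comma])).
Qed.

End IidInstance.

(** * The reduction *)

Definition prob (L : nat) (neg : bool) (k b : nat) : rat :=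
  (numer neg k b)%:R / (2 ^ (L + 4))%:R.

Definition reward (inv : bool) (a : nat) : rat :=
  if inv then a%:R^-1 else a%:R.

Definition nitem : Type := (bool * (nat * nat))%type.

Definition item_states (L k : nat) (x : nitem) : seq (rat * rat) :=
  [:: (prob L false k x.2.2, reward (~~ x.1) x.2.1);
      (prob L true k x.2.2, reward x.1 x.2.1);
      (prob L false k 0, reward x.1 x.2.1);
      (prob L true k 0, reward (~~ x.1) x.2.1)].

Fixpoint items_states (L : nat) (s : seq nitem) : seq (rat * rat) :=
  if s is x :: s' then item_states L (L - size s') x ++ items_states L s'
  else [::].

Definition main_states (L : nat) (s : seq nitem) : seq (rat * rat) :=
  (1 / (2 ^ size s)%:R, 1) :: items_states L s.

Definition item_bits (x : nitem) : item := (x.1, pair_bits x.2).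

Lemma enc_rat_frac (n d : nat) : (0 < d)%N -> coprime n d ->
  enc_rat (n%:R / d%:R) = enc_nat n ++ Slash :: enc_nat d.
Proof.
move=> d0 nd; rewrite /enc_rat !pmulrn.
rewrite coprimeq_num ?coprimeq_den //=.
have -> : (Posz d == 0) = false by apply/negbTE; rewrite -lt0n.
have -> : Num.sg (Posz d) = 1 by apply/gtr0_sg.
by rewrite mul1r.
Qed.

Lemma odd_numer neg k b : (b.*2.+1 <= 2 ^ k.+1)%N -> odd (numer neg k b).
Proof.
move=> bk; rewrite /numer expnS; case: neg.
  by rewrite oddB ?oddM //= ?odd_double // -expnS.
by rewrite oddD oddM /= odd_double.
Qed.

Lemma enc_prob L neg k bs : (size bs < k)%N ->
  enc_rat (prob L neg k (bval bs)) ++ [:: Comma] = entry_word L neg k bs.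
Proof.
move=> bk.
have bs2 : (bval bs < 2 ^ size bs)%N by exact: bval_lt.
have bk2 : (2 ^ size bs < 2 ^ k)%N by rewrite ltn_exp2l.
rewrite /prob enc_rat_frac ?expn_gt0 //; last first.
  rewrite coprime_sym coprimeXl // coprime2n odd_numer // expnS.
  by move: bs2 bk2; lia.
by rewrite /entry_word num_wordE // enc_nat_exp2 -!catA.
Qed.

Lemma enc_reward inv a : (0 < a)%N ->
  enc_rat (reward inv a) ++ [:: Comma] = reward_word inv (bits a).
Proof.
move=> a0; rewrite /reward /reward_word; case: inv.
  by rewrite -[_^-1]mul1r -[1]/(1%:R) enc_rat_frac ?coprime1n // !enc_nat_bits.
by rewrite -[a%:R]divr1 -[1]/(1%:R) enc_rat_frac ?coprimen1 // !enc_nat_bits -catA.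
Qed.

Lemma nfits_cons L (x : nitem) s : fits L (map item_bits (x :: s)) ->
  [/\ (size (bits x.2.2) + size s < L)%N & fits L (map item_bits s)].
Proof.
move=> H; have [_ h1 h2] := fits_cons H; split=> //.
by move: h1; rewrite (size_map item_bits).
Qed.

Lemma enc_items_states L s : fits L (map item_bits s) ->
  all (fun x : nitem => (0 < x.2.1)%N) s ->
  enc_rats (map fst (items_states L s)) = rows_word L (map item_bits s) /\
  enc_rats (map snd (items_states L s)) = rewards_word (map item_bits s).
Proof.
elim: s => // -[sg [a b]] s IH /nfits_cons[bL fL] /andP[a0 a0s].
simpl in bL, a0.
have [IH1 IH2] := IH fL a0s.
have bk : (size (bits b) < L - size s)%N by lia.
have k0 : (@size bool [::] < L - size s)%N by rewrite [size [::]]/=; lia.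
split.
  have -> : rows_word L (map item_bits ((sg, (a, b)) :: s)) =
      item_row L (L - size s) (sg, (bits a, bits b)) ++
      rows_word L (map item_bits s) by rewrite -[size s](size_map item_bits).
  rewrite /item_row -!enc_prob // -IH1 !bval_bits.
  by rewrite /enc_rats /= -!catA.
have -> : rewards_word (map item_bits ((sg, (a, b)) :: s)) =
    item_rewards (sg, (bits a, bits b)) ++ rewards_word (map item_bits s) by [].
rewrite /item_rewards -!enc_reward // -IH2.
by rewrite /enc_rats /= -!catA.
Qed.

Lemma count_rewards_word s :
  count is_comma (rewards_word s) = (4 * size s)%N.
Proof.
elim: s => // x s IH.
rewrite [rewards_word _]/= -/(rewards_word _) count_cat IH mulnS; congr (_ + _)%N.
have H inv a : count is_comma (reward_word inv a) = 1%N.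
  have H0 : count is_comma (map Bit a) = 0%N by elim: a.
  by rewrite /reward_word; case: inv; rewrite !count_cat H0.
by rewrite /item_rewards 3!(count_cat _ (reward_word _ _)) !H.
Qed.

Lemma size_items_states L s : size (items_states L s) = (4 * size s)%N.
Proof. by elim: s => //= x s ->; lia. Qed.

Lemma enc_main_states L s (H : prob_rewards (main_states L s)) :
  fits L (map item_bits s) -> all (fun x : nitem => (0 < x.2.1)%N) s ->
  enc_log_mp (iid_instance H) = main_word L (map item_bits s).
Proof.
move=> fL s0; rewrite enc_iid_instance /main_word.
have [E1 E2] := enc_items_states fL s0.
have -> : enc_rats (map fst (main_states L s)) = full_row L (map item_bits s).
  rewrite /full_row -E1 size_map /main_states /=.
  rewrite -[in LHS]/([:: _] ++ _) /enc_rats /=.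
  rewrite -[X in enc_rat (X / _)]/(1%:R) enc_rat_frac ?expn_gt0 ?coprime1n //.
  by rewrite enc_nat_exp2 /filler_row /= -!catA.
have -> : enc_rats (map snd (main_states L s)) = full_rewards (map item_bits s).
  by rewrite /full_rewards -E2.
rewrite /full_rewards count_cat count_rewards_word size_map.
by rewrite /= size_items_states.
Qed.

(** * Masses of the factors and drift of the chain *)

Lemma prob_gt0 L neg k b : (b < 2 ^ k)%N -> 0 < prob L neg k b.
Proof.
move=> bk; rewrite /prob divr_gt0 ?ltr0n ?expn_gt0 // /numer expnS.
by case: neg; lia.
Qed.

(** The exponent cancels in the sum, so the mass of a factor depends on its position alone. *)
Lemma probD L k b : (b < 2 ^ k)%N ->
  prob L false k b + prob L true k b = (2 ^ (k + 2))%:R / (2 ^ (L + 4))%:R.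
Proof.
move=> bk; rewrite /prob -mulrDl -natrD; congr (_%:R / _).
by rewrite /numer addn2 !expnS; lia.
Qed.

Lemma probB L k b : (b < 2 ^ k)%N ->
  prob L false k b - prob L true k b = (4 * b + 2)%:R / (2 ^ (L + 4))%:R.
Proof.
move=> bk; rewrite /prob -mulrBl; congr (_ / _).
rewrite /numer natrB; last by rewrite expnS; lia.
have -> : (4 * b + 2 = b.*2.+1 + b.*2.+1)%N by lia.
by rewrite !natrD; ring.
Qed.

Lemma fits_lt2 L (x : nitem) s : fits L (map item_bits (x :: s)) ->
  (x.2.2 < 2 ^ (L - size s))%N /\ (size s < L)%N.
Proof.
case/nfits_cons => bL _; split; last by lia.
apply: leq_trans (size_bits_ltP _) _.
by rewrite leq_exp2l //; lia.
Qed.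

(** With [n] later factors, [k = L - n], and the four states of a factor have total mass [2 ^ (k +
    3) / 2 ^ (L + 4) = 1 / 2 ^ (n + 1)]: half of what the later factors leave. *)
Lemma sum_items_states L s : fits L (map item_bits s) ->
  \sum_(pr <- items_states L s) pr.1 = 1 - 1 / (2 ^ size s)%:R.
Proof.
elim: s => [|x s IH] fL; first by rewrite big_nil /= expn0 divr1 subrr.
have [_ fL'] := nfits_cons fL; have [bk sL] := fits_lt2 fL.
have b0 : (0 < 2 ^ (L - size s))%N by rewrite expn_gt0.
rewrite /= !big_cons /= IH //.
set p1 := prob _ false _ x.2.2; set p2 := prob _ true _ x.2.2.
set p3 := prob _ false _ 0; set p4 := prob _ true _ 0.
have -> : p1 + (p2 + (p3 + (p4 + (1 - 1 / (2 ^ size s)%:R)))) =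
  (p1 + p2) + (p3 + p4) + (1 - 1 / (2 ^ size s)%:R) by ring.
rewrite !probD //.
have -> : (2 ^ (L + 4) = 2 ^ (L - size s + 2) * (4 * 2 ^ size s))%N.
  by rewrite -[4%N]/(2 ^ 2)%N -!expnD; congr expn; lia.
rewrite expnS !natrM.
have z n : (2 ^ n)%:R != 0 :> rat by rewrite pnatr_eq0 expn_eq0.
by field; rewrite !z.
Qed.

Lemma main_states_ok L s : fits L (map item_bits s) ->
  all (fun x : nitem => (0 < x.2.1)%N) s -> prob_rewards (main_states L s).
Proof.
move=> fL s0; apply/and3P; split=> //; last first.
  by rewrite big_cons /= sum_items_states // addrC subrK.
rewrite /= divr_gt0 ?ltr0n ?expn_gt0 //=.
elim: s fL s0 => // -[sg [a b]] s IH fL /andP[/= a0 a0s].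
have [bk sL] := fits_lt2 fL; have [_ fL'] := nfits_cons fL.
simpl in bk.
have b0 : (0 < 2 ^ (L - size s))%N by rewrite expn_gt0.
have r0 inv : 0 < reward inv a by case: inv; rewrite /reward ?invr_gt0 ltr0n.
by rewrite !prob_gt0 // !r0 IH.
Qed.

(** The expected logarithmic reward of one step, which will be the almost sure mean payoff. *)
Definition drift (R : realType) (e : seq (rat * rat)) : R :=
  \sum_(pr <- e) ratr pr.1 * ln (ratr pr.2).

Lemma ln_reward (R : realType) inv a : (0 < a)%N ->
  ln (ratr (reward inv a)) = (if inv then - ln a%:R else ln a%:R) :> R.
Proof.
move=> a0; rewrite /reward; case: inv; last by rewrite ratr_nat.
by rewrite fmorphV /= ratr_nat lnV // posrE ltr0n.
Qed.

Lemma drift_items (R : realType) L s : fits L (map item_bits s) ->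
  all (fun x : nitem => (0 < x.2.1)%N) s ->
  drift R (items_states L s) = 4 / (2 ^ (L + 4))%:R *
    \sum_(x <- s) (if x.1 then 1 else -1) * (x.2.2%:R * ln x.2.1%:R).
Proof.
elim: s => [|[sg [a b]] s IH] fL; first by rewrite /drift !big_nil mulr0.
move=> /andP[a0 a0s]; simpl in a0.
have [bk sL] := fits_lt2 fL; have [_ fL'] := nfits_cons fL.
simpl in bk.
have b0 : (0 < 2 ^ (L - size s))%N by rewrite expn_gt0.
rewrite big_cons mulrDr -IH // /drift /= !big_cons /= !ln_reward //.
set p1 := prob _ false _ b; set p2 := prob _ true _ b.
set p3 := prob _ false _ 0; set p4 := prob _ true _ 0.
set S := \sum_(_ <- _) _.
(* By [probB] the first difference has numerator [4 * b + 2]; the two states with exponent 0 remove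
   the summand 2, leaving a multiple of [b] with a factor independent of the position. *)
have E : 4 * b%:R / (2 ^ (L + 4))%:R = ratr ((p1 - p2) - (p3 - p4)) :> R.
  rewrite /p1 /p2 /p3 /p4 !probB // -mulrBl fmorph_div /= ratr_nat.
  congr (_ / _); rewrite rmorphB /= !ratr_nat muln0 add0n natrD addrK natrM //.
have -> : forall y z : R, 4 / (2 ^ (L + 4))%:R * (y * (b%:R * z)) =
   (4 * b%:R / (2 ^ (L + 4))%:R) * (y * z) by move=> y z; ring.
by rewrite E !rmorphB /=; clear fL; case: sg => /=; ring.
Qed.

Lemma drift_main (R : realType) L s : fits L (map item_bits s) ->
  all (fun x : nitem => (0 < x.2.1)%N) s ->
  drift R (main_states L s) = 4 / (2 ^ (L + 4))%:R *
    \sum_(x <- s) (if x.1 then 1 else -1) * (x.2.2%:R * ln x.2.1%:R).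
Proof.
move=> fL s0; rewrite -drift_items // /drift big_cons /=.
by rewrite rmorph1 ln1 mulr0 add0r.
Qed.

Definition signed_items (x : csri_instance) : seq nitem :=
  map (pair true) x.1 ++ map (pair false) x.2.

Lemma ln_prod (R : realType) (s : seq (nat * nat)) :
  all (fun ab => (0 < ab.1)%N) s ->
  ln (\prod_(ab <- s) ab.1 ^ ab.2)%N%:R =
  \sum_(ab <- s) ab.2%:R * ln ab.1%:R :> R.
Proof.
elim: s => [|[a b] s IH]; first by rewrite !big_nil ln1.
move=> /andP[/= a0 a0s]; rewrite !big_cons /= natrM.
rewrite lnM ?posrE ?ltr0n ?expn_gt0 ?a0 //.
  by rewrite IH // natrX lnXn ?ltr0n // mulr_natl.
rewrite big_seq_cond; apply: prodn_cond_gt0 => -[c d].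
by rewrite andbT => /(allP a0s) /= c0; rewrite expn_gt0 c0.
Qed.

(** Up to a positive factor the drift is the logarithm of the left product minus that of the right
    one. Positive bases make both products positive, and [ln] is increasing there. *)
Lemma drift_csri (R : realType) L x :
  fits L (map item_bits (signed_items x)) ->
  all (fun ab => (0 < ab.1)%N) x.1 -> all (fun ab => (0 < ab.1)%N) x.2 ->
  (0 < drift R (main_states L (signed_items x))) <-> csri_yes x.
Proof.
move=> fL x1 x2; rewrite drift_main //; last first.
  by rewrite all_cat !all_map; apply/andP.
rewrite pmulr_rgt0 ?divr_gt0 ?ltr0n ?expn_gt0 //.
rewrite big_cat /= !big_map /=.
have -> : \sum_(j <- x.1) 1 * (j.2%:R * ln j.1%:R) =
   ln (\prod_(ab <- x.1) ab.1 ^ ab.2)%N%:R :> R.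
  by rewrite ln_prod //; apply: eq_bigr => j _; rewrite mul1r.
have -> : \sum_(j <- x.2) -1 * (j.2%:R * ln j.1%:R) =
   - ln (\prod_(ab <- x.2) ab.1 ^ ab.2)%N%:R :> R.
  by rewrite ln_prod // -sumrN; apply: eq_bigr => j _; rewrite mulN1r.
have pos s : all (fun ab : nat * nat => (0 < ab.1)%N) s ->
    0 < (\prod_(ab <- s) ab.1 ^ ab.2)%N%:R :> R.
  move=> s0; rewrite ltr0n big_seq_cond; apply: prodn_cond_gt0 => -[c d].
  by rewrite andbT => /(allP s0) /= c0; rewrite expn_gt0 c0.
by rewrite subr_gt0 ltr_ln ?posrE ?pos // ltr_nat.
Qed.

Local Close Scope ring_scope.

Definition fix_bases (x : csri_instance) : csri_instance :=
  (map fix_base x.1, map fix_base x.2).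

(** * Sizes of instances and definition of the reduction *)

Lemma size_dfa_run s w : size (dfa_run s w).2 = size w.
Proof. by elim: w s => //= x w IH s; rewrite IH. Qed.

(** The modified instance is what the automaton writes, one letter for each letter read. *)
Lemma size_fix_bases x : size (enc_csri (fix_bases x)) = size (enc_csri x).
Proof. by rewrite -(size_dfa_run dstate0 (enc_csri x)) dfa_csri. Qed.

Lemma size_enc_pair ab :
  size (enc_pair ab) = size (bits ab.1) + size (bits ab.2) + 2.
Proof.
rewrite /enc_pair !enc_nat_bits size_cat /= size_cat.
by rewrite (size_map Bit (bits ab.1)) (size_map Bit (bits ab.2)) /=; lia.
Qed.

Definition pairs_size (s : seq (nat * nat)) : nat :=
  sumn [seq size (enc_pair ab) | ab <- s].

Lemma pairs_size_ge s : 4 * size s <= pairs_size s.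
Proof.
elim: s => // ab s IH; rewrite /pairs_size /= -/(pairs_size s) size_enc_pair.
by have := size_bits_gt0 ab.1; have := size_bits_gt0 ab.2; lia.
Qed.

Lemma size_enc_csri x : size (enc_csri x) = (pairs_size (x.1 ++ x.2)).+1.
Proof.
have H s : size (enc_powers s) = pairs_size s.
  by rewrite /enc_powers size_flatten /shape -map_comp.
rewrite /enc_csri size_cat /= !H /pairs_size map_cat sumn_cat; lia.
Qed.

Lemma map_snd_signed x : map snd (signed_items x) = x.1 ++ x.2.
Proof.
rewrite /signed_items map_cat -!map_comp /=.
by rewrite !(eq_map (g := id)) ?map_id //.
Qed.

Lemma size_signed x : size (signed_items x) <= size (enc_csri x).
Proof.
rewrite -(size_map snd) map_snd_signed size_enc_csri.
by have := pairs_size_ge (x.1 ++ x.2); lia.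
Qed.

(** The input contains all bits of the current factor and at least four letters for each later one,
    so its length exceeds the number of bits of the exponent plus the number of later factors. *)
Lemma fits_signed x :
  fits (size (enc_csri x)) (map item_bits (signed_items x)).
Proof.
move=> s1 y s2 E; rewrite size_enc_csri -map_snd_signed.
have [u1 [ab [u2 [Es <- <-]]]] : exists u1 ab u2,
   [/\ signed_items x = u1 ++ ab :: u2, item_bits ab = y &
       map item_bits u2 = s2].
  move: (signed_items x) E => s; elim: s s1 => [|z s IH] [|t s1] //=.
    by case=> <- <-; exists [::], z, s.
  case=> _ /IH [u1 [ab [u2 [-> <- <-]]]].
  by exists (z :: u1), ab, u2.
rewrite Es map_cat /= /pairs_size map_cat sumn_cat /= -!/(pairs_size _).
rewrite size_enc_pair (size_map item_bits) -(size_map snd).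
by have := pairs_size_ge (map snd u2); lia.
Qed.

Lemma bases_gt0 x : all (fun ab => 0 < ab.1) (map fix_base x).
Proof. by rewrite all_map; apply/allP => ab _ /=; lia. Qed.

Lemma signed_gt0 x :
  all (fun y : nitem => 0 < y.2.1) (signed_items (fix_bases x)).
Proof.
by rewrite all_cat !(all_map (pair _)); apply/andP; split; apply: bases_gt0.
Qed.

Definition csri_states (x : csri_instance) : seq (rat * rat) :=
  main_states (size (enc_csri x)) (signed_items (fix_bases x)).

Lemma csri_states_ok x : prob_rewards (csri_states x).
Proof.
apply: main_states_ok; last exact: signed_gt0.
by rewrite -size_fix_bases; apply: fits_signed.
Qed.

Definition trivial_states (r : rat) : seq (rat * rat) := [:: (1%R, r)].

Lemma trivial_states_ok r : (0 < r)%R -> prob_rewards (trivial_states r).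
Proof. by move=> r0; rewrite /prob_rewards /= r0 big_seq1 /= ?eqxx ?ltr01. Qed.

(** One state with a loop: reward 1 has mean payoff 0, and reward 2, in [yes_instance], has mean
    payoff [ln 2]. *)
Definition no_instance := iid_instance (trivial_states_ok (@ltr01 rat)).
Definition yes_instance := iid_instance (trivial_states_ok (@ltr0Sn rat 1)).

(** The left product is tested first: if it is 0 the strict comparison fails, even when the right
    product is 0 as well. *)
Definition reduction (x : csri_instance) : log_mp_instance :=
  if has zero_power x.1 then no_instance
  else if has zero_power x.2 then yes_instance
  else iid_instance (csri_states_ok x).

(** * Polynomial running time of the reduction *)

Lemma tm_computes_in_leq (Sigma : finType) (M : tm Sigma) n m w v : n <= m ->
  tm_computes_in M n w v -> tm_computes_in M m w v.
Proof.
move=> nm [h o]; rewrite /tm_computes_in -(subnK nm) iterD.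
set c := iter n _ _ in h o *.
have -> k : iter k (@tm_step _ M) c = c by elim: k => //= k ->; rewrite /tm_step h.
by [].
Qed.

Lemma time_bound_leq L : 0 < L -> time_bound L <= 90 * 100 * L ^ 4.
Proof.
move=> L0; rewrite /time_bound.
have h1 : L <= L ^ 2 by rewrite -{1}(expn1 L) leq_pexp2l.
have h2 : L ^ 2 <= L ^ 4 by rewrite leq_pexp2l.
have h3 : 1 <= L ^ 2 by lia.
have A : 4 * (L + 5 + L * (8 * L + 36)) + 20 <= 300 * L ^ 2.
  by move: h1 h3; rewrite -mulnn; lia.
have B : L * (4 * L + 12) + 5 <= 21 * L ^ 2.
  by move: h1 h3; rewrite -mulnn; lia.
have C := leq_mul A B.
have D : 2 * ((100 * L + 201) * L) + 10 * L + 200 <= 1000 * L ^ 2.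
  by move: h1 h3; rewrite -mulnn; lia.
have E : 300 * L ^ 2 * (21 * L ^ 2) = 63 * 100 * L ^ 4.
  by rewrite mulnACA -expnD.
rewrite E in C.
move: C D h2; move: (_ * (L * (4 * L + 12) + 5)) (L ^ 4) (L ^ 2) => X P4 P2.
move: ((100 * L + 201) * L) => Y.
by lia.
Qed.

Lemma reduction_computable (R : realType) :
  @polytime_computable symbol CSRI (LogMP R) reduction.
Proof.
set no := enc_log_mp no_instance; set yes := enc_log_mp yes_instance.
(* The two constant outputs have fixed length and are absorbed by the constant. *)
exists (prog_tm (csri_prog no yes)), (90 * 100 + size no + size yes), 4 => x /=.
have E := dfa_csri x.
set L := size (enc_csri x).
have L0 : 0 < L by rewrite /L size_enc_csri.
apply: (@tm_computes_in_leq _ _ (time_bound L + size no + size yes)).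
  have := time_bound_leq L0; have : 0 < L ^ 4 by rewrite expn_gt0 L0.
  set X := L ^ 4; clearbody X; nia.
case Ex : (enc_csri x) (erefl (enc_csri x)) => [|c w] _.
  by move: L0; rewrite /L Ex.
have EL : L = (size w).+1 by rewrite /L Ex.
rewrite EL; rewrite Ex in E.
have -> : enc_log_mp (reduction x) =
   if has zero_power x.1 then no else if has zero_power x.2 then yes else
   main_word (size w).+1 (map item_bits (signed_items (fix_bases x))).
  rewrite /reduction; case: ifP => // _; case: ifP => // _.
  rewrite enc_main_states ?signed_gt0 // -?EL //.
  by rewrite /L -size_fix_bases; apply: fits_signed.
have Ei : map item_bits (signed_items (fix_bases x)) =
   map (pair true) (map pair_bits (map fix_base x.1)) ++
   map (pair false) (map pair_bits (map fix_base x.2)).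
  by rewrite /signed_items map_cat -!map_comp.
rewrite Ei; apply: csri_prog_computes E _ _ _.
- rewrite /enc_csri /enc_powers -!map_comp.
  by congr (flatten _ ++ Hash :: flatten _); apply: eq_map => ab;
     exact: (enc_pair_syms (fix_base ab)).
- by rewrite -Ei -EL /L -size_fix_bases; apply: fits_signed.
- by rewrite -Ei size_map -EL /L -size_fix_bases; apply: size_signed.
Qed.

(** * Correctness of the reduction, given the law of large numbers *)

Lemma no_instance_drift (R : realType) :
  drift R (trivial_states 1) = 0%R.
Proof. by rewrite /drift big_seq1 /= rmorph1 ln1 mulr0. Qed.

Lemma yes_instance_drift (R : realType) :
  (0 < drift R (trivial_states (1 + 1)%:R))%R.
Proof. by rewrite /drift big_seq1 /= rmorph1 ratr_nat mul1r ln_gt0 // ltr1n. Qed.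

Lemma prod_zero_power (s : seq (nat * nat)) :
  (\prod_(ab <- s) ab.1 ^ ab.2 == 0) = has zero_power s.
Proof.
elim: s => [|[a b] s IH]; first by rewrite big_nil.
by rewrite big_cons muln_eq0 IH /= expn_eq0.
Qed.

Lemma prod_fix_base (s : seq (nat * nat)) : ~~ has zero_power s ->
  \prod_(ab <- map fix_base s) ab.1 ^ ab.2 = \prod_(ab <- s) ab.1 ^ ab.2.
Proof.
elim: s => [|[a b] s IH] /=; first by rewrite !big_nil.
rewrite negb_or => /andP[ab /IH{}IH]; rewrite !big_cons IH; congr (_ * _).
move: ab; rewrite /zero_power /=; case: (posnP a) => [->|a0 _] /=.
  by case: (posnP b) => // ->; rewrite !expn0.
by have -> : maxn a 1 = a by lia.
Qed.

Lemma reduction_correct (R : realType) :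
  (forall e (He : prob_rewards e),
     log_mp_yes R (iid_instance He) <-> (0 < drift R e)%R) ->
  forall x, csri_yes x <-> log_mp_yes R (reduction x).
Proof.
move=> iid x; rewrite /reduction /csri_yes.
case: ifP => [z1|/negbT z1].
  rewrite /no_instance iid no_instance_drift ltxx.
  by move: z1; rewrite -prod_zero_power => /eqP ->.
case: ifP => [z2|/negbT z2].
  rewrite iid; split=> [_|_]; first exact: yes_instance_drift.
  by move: z1 z2; rewrite -!prod_zero_power => z1 /eqP ->; rewrite lt0n.
rewrite iid -(prod_fix_base z1) -(prod_fix_base z2).
rewrite drift_csri ?bases_gt0 //.
by rewrite -size_fix_bases; apply: fits_signed.
Qed.

Import numFieldNormedType.Exports.
Local Open Scope classical_set_scope.
Local Open Scope ring_scope.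

(** * The law of large numbers *)

Section PathMeasurability.
Variables (S : finType) (s0 : S).
Local Notation T := (path_sigma s0).

Lemma measurable_cylinder n q : measurable (@cylinder S s0 n q : set T).
Proof. by apply: sub_gen_smallest; exists n, q. Qed.

(** Such a set is the union of the cylinders contained in it that are given by words, and words over
    a finite alphabet are countable; [pickle] numbers them. *)
Lemma measurable_finitary n (A : set T) :
  (forall rho rho' : nat -> S, (forall i, (i <= n)%N -> rho i = rho' i) ->
     A rho -> A rho') -> measurable A.
Proof.
move=> HA.
pose F k : set T := @cylinder S s0 n (nth s0 (odflt [::] (@unpickle (seq S) k))).
have -> : A = \bigcup_(k in [set k | F k `<=` A]) F k.
  apply/seteqP; split=> [rho Arho|rho [k /= FA /FA //]].
  have Frho : F (pickle (mkseq rho n.+1)) rho.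
    by move=> i ni; rewrite pickleK /= nth_mkseq.
  exists (pickle (mkseq rho n.+1)) => //= rho' Frho'.
  by apply: (HA rho) Arho => i ni; rewrite Frho // Frho'.
by apply: bigcup_measurable => k _; apply: measurable_cylinder.
Qed.

Lemma measurable_fun_finitary n d (U : measurableType d) (f : T -> U) :
  (forall rho rho' : nat -> S, (forall i, (i <= n)%N -> rho i = rho' i) ->
     f rho = f rho') -> measurable_fun [set: T] f.
Proof.
move=> Hf _ B mB; rewrite setTI; apply: (@measurable_finitary n).
by move=> rho rho' E; rewrite /preimage /= (Hf _ _ E).
Qed.

End PathMeasurability.

(** * Fourth moments of sums of independent centered letters *)

Section WordExpectation.
Variables (S : finType) (R : realType) (p : S -> R).

(** The expectation of [F] over words of [n] independent letters, as an iterated finite sum, so that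
    moments are computed by algebra alone. *)
Fixpoint word_expect (n : nat) (F : seq S -> R) : R :=
  if n is n'.+1 then \sum_s p s * word_expect n' (fun u => F (s :: u))
  else F [::].

Lemma eq_word_expect n F G : F =1 G -> word_expect n F = word_expect n G.
Proof.
elim: n F G => [|n IH] F G FG /=; first exact: FG.
by apply: eq_bigr => s _; congr (_ * _); apply: IH => u.
Qed.

Hypothesis p1 : \sum_s p s = 1.
Variable X : S -> R.
Hypothesis X0 : \sum_s p s * X s = 0.

Definition moment k := \sum_s p s * X s ^+ k.

(* The offset [a] makes the closed form provable by splitting off the first
   letter. *)
Lemma word_expect4 n a :
  word_expect n (fun u => (a + \sum_(x <- u) X x) ^+ 4) =
  a ^+ 4 + 6 * a ^+ 2 * n%:R * moment 2 + 4 * a * n%:R * moment 3 +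
  n%:R * moment 4 + 3 * n%:R * (n%:R - 1) * moment 2 ^+ 2.
Proof.
elim: n a => [|n IH] a; first by rewrite /= big_nil; ring.
rewrite /=.
have -> : \sum_s p s *
    word_expect n (fun u => (a + \sum_(x <- s :: u) X x) ^+ 4) =
  \sum_s ((a ^+ 4 + 6 * a ^+ 2 * n%:R * moment 2 + 4 * a * n%:R * moment 3 +
     n%:R * moment 4 + 3 * n%:R * (n%:R - 1) * moment 2 ^+ 2) * p s +
   (4 * a ^+ 3 + 12 * a * n%:R * moment 2 + 4 * n%:R * moment 3) * (p s * X s) +
   (6 * a ^+ 2 + 6 * n%:R * moment 2) * (p s * X s ^+ 2) +
   4 * a * (p s * X s ^+ 3) + p s * X s ^+ 4).
  apply: eq_bigr => s _.
  rewrite (@eq_word_expect _ _ (fun u => ((a + X s) + \sum_(x <- u) X x) ^+ 4)).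
    by rewrite IH; ring.
  by move=> u; rewrite big_cons addrA.
rewrite !big_split /= -!mulr_sumr p1 X0 -!/(moment _) -natr1.
by ring.
Qed.

Lemma word_expect4_le a : (forall s, 0 <= p s) ->
  exists2 K, 0 <= K & forall n,
  word_expect n (fun u => (a + \sum_(x <- u) X x) ^+ 4) <= K * n.+1%:R ^+ 2.
Proof.
move=> p0.
have m2 : 0 <= moment 2.
  by apply: sumr_ge0 => s _; rewrite mulr_ge0 ?sqr_ge0.
have m4 : 0 <= moment 4.
  by apply: sumr_ge0 => s _; rewrite mulr_ge0 // (exprM _ 2 2) sqr_ge0.
have a4 : 0 <= a ^+ 4 by rewrite (exprM _ 2 2) sqr_ge0.
have a2 := sqr_ge0 a.
have b0 : 0 <= 6 * a ^+ 2 * moment 2 by apply: mulr_ge0 => //; apply: mulr_ge0.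
have d0 := sqr_ge0 (moment 2).
exists (a ^+ 4 + 6 * a ^+ 2 * moment 2 + `|4 * a * moment 3| + moment 4 +
        3 * moment 2 ^+ 2).
  by rewrite !addr_ge0 // mulr_ge0.
move=> n; rewrite word_expect4.
have n0 : 0 <= n%:R :> R by rewrite ler0n.
have h1 : 1 <= n.+1%:R ^+ 2 :> R by rewrite exprn_ege1 // ler1n.
have h2 : n%:R <= n.+1%:R ^+ 2 :> R by rewrite -natr1; nra.
have h3 : n%:R * (n%:R - 1) <= n.+1%:R ^+ 2 :> R by rewrite -natr1; nra.
move: (n.+1%:R ^+ 2) h1 h2 h3 => N2 h1 h2 h3.
have i1 := ler_wpM2l a4 h1.
have i2 := ler_wpM2l b0 h2.
(* The third moment may have either sign, hence the absolute value in the constant. *)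
have i3 : 4 * a * moment 3 * n%:R <= `|4 * a * moment 3| * N2.
  apply: le_trans (ler_norm _) _.
  by rewrite normrM [`|n%:R|]ger0_norm //; apply: ler_wpM2l.
have i4 := ler_wpM2l m4 h2.
have i5 := ler_wpM2l d0 h3.
by lra.
Qed.

End WordExpectation.

(** * Integrals of functions of finitely many coordinates *)

Section IidLaw.
Variables (S : finType) (s0 : S) (R : realType) (p : S -> R).
Local Notation T := (path_sigma s0).
Variable P : probability T R.
Hypothesis P_cylinder : forall n q,
  P (@cylinder S s0 n q) = ((q 0%N == s0)%:R * \prod_(i < n) p (q i.+1))%:E.

Lemma cylinder_split n q :
  (@cylinder S s0 n q : set T) = \big[setU/set0]_(s <- index_enum S)
    (@cylinder S s0 n.+1 (fun i => if i == n.+1 then s else q i) : set T).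
Proof.
rewrite -bigcup_seq; apply/seteqP; split=> [rho Hrho|rho [s _ Hrho] i ni].
  exists (rho n.+1); first exact: mem_index_enum.
  move=> i; rewrite leq_eqVlt; case: eqVneq => [->|_] //=; exact: Hrho.
by rewrite Hrho ?(leq_trans ni) //; case: eqVneq ni => // ->; rewrite ltnn.
Qed.

Lemma cylinder_triv n q : trivIset [set` index_enum S]
  (fun s => @cylinder S s0 n.+1 (fun i => if i == n.+1 then s else q i) : set T).
Proof.
move=> s t _ _ [rho [/(_ n.+1 (leqnn _)) Hs /(_ n.+1 (leqnn _)) Ht]].
by move: Hs Ht; rewrite eqxx => <- <-.
Qed.

(** Induction on [n]: splitting the cylinder by its next letter [s] contributes the factor [p s],
    exactly as in the recursion of [word_expect]. *)
Lemma integral_suffix n (F : seq S -> R) m q : (forall u, 0 <= F u) ->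
  (\int[P]_(rho in (@cylinder S s0 m q : set T))
     (F (mkseq (fun i => (rho : nat -> S) (m.+1 + i)%N) n))%:E =
   P (@cylinder S s0 m q) * (word_expect p n F)%:E)%E.
Proof.
elim: n F m q => [|n IH] F m q F0.
  rewrite (@eq_integral _ _ _ P _ (cst (F [::])%:E)) //.
  by rewrite integral_cst; [rewrite muleC | exact: measurable_cylinder].
rewrite [in LHS]cylinder_split ge0_integral_bigsetU /=; first last.
- by move=> rho _; rewrite lee_fin.
- apply: (@measurable_funS _ _ _ _ setT) => //; apply/measurable_EFinP.
  apply: (@measurable_fun_finitary _ _ (m + n.+2)) => rho rho' E.
  by congr F; apply/eq_in_map => i; rewrite mem_iota => ?; apply: E; lia.
- exact: cylinder_triv.
- exact: index_enum_uniq.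
- by move=> s; apply: measurable_cylinder.
transitivity (\sum_(s : S) P (@cylinder S s0 m q) *
   (p s * word_expect p n (fun u => F (s :: u)))%:E)%E.
  apply: eq_bigr => s _.
  set q' := fun i => _.
  rewrite (@eq_integral _ _ _ P _ (fun rho : T =>
     (F (s :: mkseq (fun i => (rho : nat -> S) (m.+2 + i)%N) n))%:E)); last first.
    move=> rho; rewrite inE => Hrho; congr (F _)%:E.
    rewrite /mkseq /= addn0 Hrho // /q' eqxx; congr (_ :: _).
    rewrite -[1%N]/(1 + 0)%N iotaDl -map_comp; apply: eq_map => i /=.
    by rewrite add1n addnS !addSn.
  rewrite (IH (fun u => F (s :: u))) // EFinM muleA; congr (_ * _)%E.
  rewrite !P_cylinder -EFinM big_ord_recr /= /q' eqxx /= mulrA.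
  congr (_ * _ * _)%:E; apply: eq_bigr => i _ /=.
  by have := ltn_ord i; case: eqVneq => // [[->]]; rewrite ltnn.
rewrite P_cylinder -EFinM mulr_sumr -sumEFin.
by apply: eq_bigr => s _; rewrite EFinM.
Qed.

Lemma integral_prefix n (G : seq S -> R) : (forall u, 0 <= G u) ->
  (\int[P]_(rho in [set: T]) (G (mkseq (rho : nat -> S) n.+1))%:E =
   (word_expect p n (fun u => G (s0 :: u)))%:E)%E.
Proof.
move=> G0.
have -> : [set: T] = \big[setU/set0]_(s <- index_enum S)
    (@cylinder S s0 0 (fun=> s) : set T).
  rewrite -bigcup_seq; apply/seteqP; split=> // rho _.
  exists (rho 0%N); first exact: mem_index_enum.
  by move=> i; rewrite leqn0 => /eqP ->.
rewrite ge0_integral_bigsetU /=; first last.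
- by move=> rho _; rewrite lee_fin.
- apply: (@measurable_funS _ _ _ _ setT) => //; apply/measurable_EFinP.
  apply: (@measurable_fun_finitary _ _ n) => rho rho' E.
  by congr G; apply/eq_in_map => i; rewrite mem_iota => ?; apply: E; lia.
- move=> s t _ _ [rho [/(_ 0%N (leqnn _)) Hs /(_ 0%N (leqnn _)) Ht]].
  by rewrite -Hs -Ht.
- exact: index_enum_uniq.
- by move=> s; apply: measurable_cylinder.
transitivity (\sum_(s : S) (((s == s0)%:R * word_expect p n (fun u => G (s :: u)))%:E : \bar R))%E.
  apply: eq_bigr => s _.
  rewrite (@eq_integral _ _ _ P _ (fun rho : T =>
     (G (s :: mkseq (fun i => (rho : nat -> S) (1 + i)%N) n))%:E)); last first.
    move=> rho; rewrite inE => Hrho; congr (G _)%:E.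
    rewrite /mkseq /= Hrho //; congr (_ :: _).
    by rewrite -[1%N]/(1 + 0)%N iotaDl -map_comp; apply: eq_map => i /=.
  rewrite (@integral_suffix n (fun u => G (s :: u))) //.
  by rewrite P_cylinder big_ord0 mulr1 EFinM.
rewrite sumEFin (bigD1 s0) //= eqxx mul1r big1 ?addr0 // => s /negbTE ->.
by rewrite mul0r.
Qed.

End IidLaw.

Lemma word_expectZ (S : finType) (R : realType) (p : S -> R) n c F :
  word_expect p n (fun u => c * F u) = c * word_expect p n F.
Proof.
elim: n F => //= n IH F; rewrite mulr_sumr; apply: eq_bigr => s _.
by rewrite IH mulrCA.
Qed.

(** The sum is dominated by a telescoping one, since [1 / (n + 1) ^ 2 <= 2 / (n + 1) - 2 / (n +
    2)]. *)
Lemma sum_inv_sqr_le (R : realType) n :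
  \sum_(0 <= i < n) i.+1%:R ^- 2 <= 2 - 2 / n.+1%:R :> R.
Proof.
elim: n => [|n IH]; first by rewrite big_nil divr1 subrr.
rewrite big_nat_recr //=; apply: le_trans (lerD IH (lexx _)) _.
rewrite -(natr1 n.+1) -(natr1 n).
have n0 : 0 <= n%:R :> R by rewrite ler0n.
set x : R := n%:R in n0 *.
have x1 : x + 1 != 0 by rewrite gt_eqF // ltr_wpDl.
have x2 : x + 1 + 1 != 0 by rewrite gt_eqF // !ltr_wpDl // addr_ge0.
rewrite -subr_ge0.
have -> : 2 - 2 / (x + 1 + 1) - (2 - 2 / (x + 1) + (x + 1) ^- 2) =
  x / ((x + 1) ^+ 2 * (x + 1 + 1)) by field; rewrite x1 x2.
by rewrite divr_ge0 // mulr_ge0 ?sqr_ge0 // !addr_ge0.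
Qed.

Lemma nneseries_inv_sqr (R : realType) (K : R) (u : nat -> \bar R) : 0 <= K ->
  (forall n, (0 <= u n)%E) ->
  (forall n, (u n <= (K * n.+1%:R ^- 2)%:E)%E) -> (\sum_(n <oo) u n < +oo)%E.
Proof.
move=> K0 u0 uK; apply: (@le_lt_trans _ _ (K * 2)%:E); last exact: ltry.
apply: lime_le; first by apply: is_cvg_nneseries.
apply: nearW => n.
apply: (@le_trans _ _ (\sum_(0 <= i < n) (K * i.+1%:R ^- 2)%:E)%E).
  exact: lee_sum.
rewrite sumEFin lee_fin -mulr_sumr ler_wpM2l //.
by apply: le_trans (sum_inv_sqr_le R n) _; rewrite gerBl divr_ge0.
Qed.

Lemma measurable_mean_payoff (S : finType) (s0 : S) (R : realType) (w : S -> R) :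
  measurable_fun [set: path_sigma s0]
    (fun rho : path_sigma s0 => mean_payoff w rho).
Proof.
pose f n (rho : path_sigma s0) : \bar R :=
  (n.+1%:R^-1 * \sum_(i < n.+1) w ((rho : nat -> S) i))%:E.
have mf n : measurable_fun [set: path_sigma s0] (f n).
  apply/measurable_EFinP.
  apply: (@measurable_fun_finitary _ _ n) => rho rho' E.
  by congr (_ * _); apply: eq_bigr => i _; rewrite E // -ltnS.
apply: (@emeasurable_fun_cvg _ _ _ _ (fun n rho => einfs (f^~ rho) n)).
  by move=> n; apply: measurable_fun_einfs.
by move=> rho _; rewrite /mean_payoff limn_einf_lim; apply: is_cvg_einfs.
Qed.

Lemma cvg_expr4 (R : realType) (u : nat -> R) :
  (fun n => u n ^+ 4) @ \oo --> (0 : R) -> u @ \oo --> (0 : R).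
Proof.
move=> /cvgrPdist_lt H; apply/cvgrPdist_lt => e e0.
have e4 : 0 < e ^+ 4 by rewrite exprn_gt0.
near=> n; have : `|0 - u n ^+ 4| < e ^+ 4 by near: n; apply: H.
rewrite !sub0r !normrN normrX; apply: contraTT; rewrite -!leNgt => h.
by rewrite lerXn2r // ?nnegrE // ltW.
Unshelve. all: by end_near. Qed.

(** * The almost sure and the expected mean payoff *)

Section MeanPayoff.
Variables (S : finType) (s0 : S) (R : realType) (p : S -> R).
Hypothesis p0 : forall s, 0 <= p s.
Hypothesis p1 : \sum_s p s = 1.
Local Notation T := (path_sigma s0).
Variable P : probability T R.
Hypothesis P_cylinder : forall n q,
  P (@cylinder S s0 n q) = ((q 0%N == s0)%:R * \prod_(i < n) p (q i.+1))%:E.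
Variable w : S -> R.
Let mu := \sum_s p s * w s.
Let X s := w s - mu.

Let X0 : \sum_s p s * X s = 0.
Proof.
rewrite /X; under eq_bigr do rewrite mulrBr.
by rewrite sumrB -mulr_suml p1 mul1r subrr.
Qed.

Let D n (rho : T) := n.+1%:R^-1 * \sum_(i < n.+1) X ((rho : nat -> S) i).

Let D4_ge0 n rho : 0 <= D n rho ^+ 4.
Proof. by rewrite (exprM _ 2 2) sqr_ge0. Qed.

Let mD4 n : measurable_fun [set: T] (fun rho => (D n rho ^+ 4)%:E).
Proof.
apply/measurable_EFinP.
apply: (@measurable_fun_finitary _ _ n) => rho rho' E.
by congr ((_ * _) ^+ _); apply: eq_bigr => i _; rewrite E // -ltnS.
Qed.

Let integral_D4 : exists2 K, 0 <= K & forall n,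
  (\int[P]_(rho in [set: T]) (D n rho ^+ 4)%:E <= (K * n.+1%:R ^- 2)%:E)%E.
Proof.
(* The first state is always [s0], so its deviation enters as the constant offset and only the
   remaining [n] letters are random. *)
have [K K0 HK] := @word_expect4_le _ _ p p1 X X0 (X s0) p0.
exists K => // n.
pose G u := (n.+1%:R^-1 * \sum_(x <- u) X x) ^+ 4.
have -> : (\int[P]_(rho in [set: T]) (D n rho ^+ 4)%:E =
    \int[P]_(rho in [set: T]) (G (mkseq (rho : nat -> S) n.+1))%:E)%E.
  apply: eq_integral => rho _; congr ((_ * _) ^+ _)%:E.
  by rewrite big_map -/(index_iota 0 n.+1) big_mkord.
rewrite (@integral_prefix S s0 R p P P_cylinder); last first.
  by move=> u; rewrite /G (exprM _ 2 2) sqr_ge0.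
rewrite lee_fin (@eq_word_expect _ _ _ _ _ (fun u => n.+1%:R^-1 ^+ 4 *
   (X s0 + \sum_(x <- u) X x) ^+ 4)); last first.
  by move=> u; rewrite /G big_cons exprMn.
rewrite word_expectZ.
apply: le_trans (ler_wpM2l _ (HK n)) _; first by rewrite exprn_ge0 // invr_ge0.
rewrite le_eqVlt; apply/orP; left; apply/eqP.
by field; rewrite addrC natr1 pnatr_eq0.
Qed.

(** The integrals of [D n ^ 4] are summable, so the series [Z] is integrable and hence finite almost
    everywhere. There its terms tend to 0, and the averages converge to [mu]. *)
Lemma expected_mean_payoff_iid : expected_mean_payoff w P = mu%:E.
Proof.
have [K K0 HK] := integral_D4.
pose Z (rho : T) : \bar R := (\sum_(n <oo) (D n rho ^+ 4)%:E)%E.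
have Z0 rho : (0 <= Z rho)%E by apply: nneseries_ge0 => n _ _; rewrite lee_fin.
have mZ : measurable_fun [set: T] Z.
  by apply: ge0_emeasurable_sum => // n rho _ _; rewrite lee_fin.
have iZ : P.-integrable [set: T] Z.
  apply/integrableP; split=> //.
  under eq_integral do rewrite gee0_abs //.
  rewrite integral_nneseries //.
    apply: (nneseries_inv_sqr K0) => // n.
    by apply: integral_ge0 => rho _; rewrite lee_fin.
  by move=> n rho _; rewrite lee_fin.
have aeZ := integrable_ae measurableT iZ.
rewrite /expected_mean_payoff (ae_eq_integral (cst mu%:E)) //.
- rewrite integral_cst // -[RHS]mule1; congr (_ * _)%E.
  exact: (probability_setT P).
- exact: measurable_mean_payoff.
apply: filterS aeZ => rho /(_ I) Zfin _.
rewrite /mean_payoff /=.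
have cD : (fun n => D n rho) @ \oo --> (0 : R).
  apply: cvg_expr4; apply: cvg_series_cvg_0; apply: nnseries_is_cvg => //.
  by rewrite ltey_eq Zfin.
have cA : (fun n => n.+1%:R^-1 * \sum_(i < n.+1) w ((rho : nat -> S) i)) @ \oo
    --> mu.
  have -> : (fun n => n.+1%:R^-1 * \sum_(i < n.+1) w ((rho : nat -> S) i)) =
     (fun n => mu + D n rho).
    apply/funext => n; rewrite /D /X sumrB sumr_const card_ord mulrBr.
    by rewrite -[mu *+ _]mulr_natl mulKf ?pnatr_eq0 // addrCA subrr addr0.
  by rewrite -[X in _ --> X]addr0; apply: cvgD => //; apply: cvg_cst.
have cE : (fun n => (n.+1%:R^-1 * \sum_(i < n.+1) w ((rho : nat -> S) i))%:E)
    @ \oo --> mu%:E by apply: cvg_EFin => //; apply: nearW.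
by have [-> _] := cvg_limn_einf_sup cE.
Qed.

End MeanPayoff.

(** * Existence of the path measure *)

Section Digits.
Variables (R : realType) (k : nat) (p : 'I_k -> R) (s0 : 'I_k).
Hypothesis p_gt0 : forall s, 0 < p s.
Hypothesis p_sum : \sum_s p s = 1.

Definition cumul (m : nat) : R := \sum_(s < k | (s < m)%N) p s.

Lemma cumul0 : cumul 0 = 0.
Proof. by rewrite /cumul big_pred0. Qed.

Lemma cumul_max : cumul k = 1.
Proof. by rewrite -p_sum; apply: eq_bigl => s; rewrite ltn_ord. Qed.

Lemma cumulS (s : 'I_k) : cumul s.+1 = cumul s + p s.
Proof.
rewrite /cumul (bigD1 s) //= addrC; congr (_ + _); apply: eq_bigl => t.
by rewrite ltnS ltn_neqAle andbC.
Qed.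

Lemma cumul_le m n : (m <= n)%N -> cumul m <= cumul n.
Proof.
move=> mn; rewrite [leRHS](bigID (fun s : 'I_k => (s < m)%N)) /=.
rewrite [X in X + _](_ : _ = cumul m); last first.
  by apply: eq_bigl => s; case: (ltnP s m) => sm; rewrite ?andbF // andbT (leq_trans sm).
by rewrite lerDl; apply: sumr_ge0 => s _; rewrite ltW.
Qed.

Definition in_cell (u : R) (s : 'I_k) : bool := cumul s <= u < cumul s + p s.

Lemma in_cell_inj u s t : in_cell u s -> in_cell u t -> s = t.
Proof.
wlog st : s t / (s <= t)%N.
  by move=> H; case: (leqP s t) => [/H//|/ltnW/H H' *]; apply/esym/H'.
rewrite /in_cell -!cumulS => /andP[_ us] /andP[tu _].
apply/val_inj/eqP; rewrite eqn_leq st /= leqNgt; apply/negP => st'.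
by have := cumul_le st'; rewrite leNgt (le_lt_trans tu us).
Qed.

Lemma in_cell_ex u : 0 <= u < 1 -> exists s, in_cell u s.
Proof.
move=> /andP[u0 u1]; rewrite -cumul_max in u1.
have : exists2 m, (m <= k)%N & u < cumul m by exists k.
case=> m; elim: m => [|m IH] mk um; first by rewrite cumul0 ltNge u0 in um.
case: (ltP u (cumul m)) => [/IH|mu]; first by apply; exact: ltnW.
by exists (Ordinal mk); rewrite /in_cell mu -cumulS.
Qed.

Definition digit (u : R) : 'I_k := odflt s0 [pick s | in_cell u s].
Definition shift (u : R) : R := (u - cumul (digit u)) / p (digit u).

Lemma digitE u s : 0 <= u < 1 -> (digit u == s) = in_cell u s.
Proof.
move=> u01; rewrite /digit; case: pickP => [t ut|H] /=; last first.
  by have [t] := in_cell_ex u01; rewrite H.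
by apply/eqP/idP => [<- //|]; apply: in_cell_inj.
Qed.

Lemma shift_itv u : 0 <= u < 1 -> 0 <= shift u < 1.
Proof.
move=> u01; have : in_cell u (digit u) by rewrite -digitE.
rewrite /in_cell /shift => /andP[h1 h2].
apply/andP; split; first by apply: divr_ge0; rewrite ?subr_ge0 // ltW.
by rewrite ltr_pdivrMr // mul1r ltrBlDl.
Qed.

(** The left end of the interval of points whose expansion starts with [v]; [width v] is its
    length. *)
Fixpoint left_end (v : seq 'I_k) : R :=
  if v is s :: v' then cumul s + p s * left_end v' else 0.
Definition width (v : seq 'I_k) : R := \prod_(s <- v) p s.

Lemma width_gt0 v : 0 < width v.
Proof. by rewrite /width; apply: prodr_gt0. Qed.

Lemma left_end_bounds v : 0 <= left_end v /\ left_end v + width v <= 1.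
Proof.
elim: v => [|s v [IH1 IH2]] /=; first by rewrite /width big_nil add0r.
have c0 : 0 <= cumul s by rewrite -cumul0 cumul_le.
have c1 : cumul s + p s <= 1 by rewrite -cumulS -cumul_max cumul_le.
have ps := p_gt0 s.
split; first by rewrite addr_ge0 // mulr_ge0 // ltW.
rewrite /width big_cons -/(width v) -addrA -mulrDr.
apply: le_trans c1; rewrite lerD2l -[leRHS]mulr1 ler_wpM2l //.
exact: ltW.
Qed.

(** A first digit [s] confines [u] to the cell of [s], which [shift] maps affinely onto the unit
    interval; induction applies to the image. *)
Lemma digits_itv v u : 0 <= u < 1 ->
  (mkseq (fun i => digit (iter i shift u)) (size v) == v) =
  (left_end v <= u < left_end v + width v).
Proof.
elim: v u => [|s v IH] u u01 /=; first by rewrite /width big_nil add0r u01 eqxx.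
have -> : (mkseq (fun i => digit (iter i shift u)) (size v).+1 == s :: v) =
   (digit u == s) &&
   (mkseq (fun i => digit (iter i shift (shift u))) (size v) == v).
  rewrite /mkseq /= eqseq_cons -[1%N]/(1 + 0)%N iotaDl -map_comp.
  by congr (_ && (_ == _)); apply: eq_map => i /=; rewrite -iterSr.
rewrite (IH _ (shift_itv u01)) digitE //.
have [l0 l1] := left_end_bounds v; have ps := p_gt0 s.
have w0 := width_gt0 v.
rewrite /width big_cons -/(width v).
case: (boolP (in_cell u s)) => us /=.
  have -> : shift u = (u - cumul s) / p s.
    by rewrite /shift; have /eqP -> : digit u == s by rewrite digitE.
  rewrite ler_pdivlMr // ltr_pdivrMr // lerBrDl ltrBlDl mulrC.
  by rewrite [_ * p s]mulrC mulrDr addrA.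
(* The interval of [s :: v] lies inside the cell of [s], so outside this cell both sides are
   false. *)
apply/esym/negbTE; apply: contra us => /andP[h1 h2]; apply/andP; split.
  by apply: le_trans h1; rewrite lerDl mulr_ge0 // ltW.
apply: lt_le_trans h2 _; rewrite -addrA lerD2l -mulrDr -[leRHS]mulr1.
by rewrite ler_wpM2l // ltW.
Qed.

Local Notation T := (path_sigma s0).

Definition unit_itv : set (measurableTypeR R) := `[0, 1[%classic.

(** Coordinate 0 is the start state, so coordinate [i] is digit number [i.-1]. Points outside the
    unit interval, a null set for [leb01], are sent to the constant path. *)
Definition coder (u : measurableTypeR R) : T := fun i =>
  if (0 <= (u : R) < 1) && (0 < i)%N then digit (iter i.-1 shift u) else s0.

Definition word_itv (v : seq 'I_k) : set (measurableTypeR R) :=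
  `[left_end v, left_end v + width v[%classic.

Lemma coder_cylinder n (q : nat -> 'I_k) :
  coder @^-1` (@cylinder _ s0 n q) `&` unit_itv =
  if q 0%N == s0 then word_itv (mkseq (fun i => q i.+1) n) else set0.
Proof.
apply/seteqP; split=> u; rewrite /unit_itv /word_itv /= in_itv /=.
  case=> H u01; have <- : coder u 0 = q 0%N by exact: H.
  rewrite {1}/coder /= andbF eqxx /= in_itv /=.
  rewrite -digits_itv // size_mkseq; apply/eqP/eq_in_map => i.
  by rewrite mem_iota /= => ni; rewrite -H // /coder u01.
case: eqP => // q0; rewrite /= in_itv /= => Hu.
set v := mkseq _ n in Hu.
have [l0 l1] := left_end_bounds v.
have u01 : 0 <= u < 1.
  by case/andP: Hu => h1 h2; rewrite (le_trans l0 h1) (lt_le_trans h2 l1).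
split=> // -[|i] ni; rewrite /coder u01 //=.
move: Hu; rewrite -digits_itv // size_mkseq => /eqP/(congr1 (nth s0 ^~ i)).
by rewrite !nth_mkseq.
Qed.

Lemma measurable_unit_itv : measurable unit_itv.
Proof. exact: measurable_itv. Qed.

Lemma measurable_coder : measurable_fun [set: measurableTypeR R] coder.
Proof.
apply: (@measurability _ _ (measurableTypeR R) T setT coder (@cylinders _ s0) erefl).
move=> _ [_ [n [q ->]] <-]; rewrite setTI.
(* Inside the unit interval the preimage of a cylinder is an interval or empty. Outside, [coder] is
   constant, so the preimage is the whole complement or empty. *)
rewrite -[X in measurable X](setIT _) -(setUv unit_itv) setIUr.
apply: measurableU.
  rewrite coder_cylinder; case: ifP => _ //; exact: measurable_itv.
case: (pselect (forall i, (i <= n)%N -> q i = s0)) => H.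
  have -> : coder @^-1` (@cylinder _ s0 n q) `&` ~` unit_itv = ~` unit_itv.
    apply/seteqP; split=> u; first by case.
    move=> Hu; split=> // i ni; rewrite H // /coder.
    by case: ifP => // /andP[u01 _]; case: Hu; rewrite /unit_itv /= in_itv.
  by apply: measurableC; exact: measurable_unit_itv.
have -> : coder @^-1` (@cylinder _ s0 n q) `&` ~` unit_itv = set0 => //.
apply/seteqP; split=> // u [Hu nu]; apply: H => i ni.
rewrite -Hu // /coder; case: ifP => // /andP[u01 _].
by case: nu; rewrite /unit_itv /= in_itv.
Qed.

Let leb01 : {measure set (measurableTypeR R) -> \bar R} :=
  mrestr (@lebesgue_measure R) measurable_unit_itv.

Definition iid_law (A : set T) : \bar R := leb01 (coder @^-1` A).

Let iid_law0 : iid_law set0 = 0%E.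
Proof. by rewrite /iid_law preimage_set0 measure0. Qed.

Let iid_law_ge0 A : (0 <= iid_law A)%E.
Proof. exact: measure_ge0. Qed.

Let iid_law_sigma_additive : semi_sigma_additive iid_law.
Proof.
move=> F mF tF mUF; rewrite /iid_law preimage_bigcup.
apply: measure_semi_sigma_additive.
- by move=> n; rewrite -[X in measurable X]setTI; exact: measurable_coder.
- apply/trivIsetP => /= i j _ _ ij; rewrite -preimage_setI.
  by move/trivIsetP : tF => /(_ _ _ _ _ ij) ->//; rewrite preimage_set0.
- by rewrite -preimage_bigcup -[X in measurable X]setTI; exact: measurable_coder.
Qed.

HB.instance Definition _ := isMeasure.Build _ _ _ iid_law
  iid_law0 iid_law_ge0 iid_law_sigma_additive.

Let iid_law_setT : iid_law [set: T] = 1%E.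
Proof.
rewrite /iid_law preimage_setT /leb01 /= /mrestr setTI.
by rewrite lebesgue_measure_itv /= lte_fin ltr01 oppr0 addr0.
Qed.

HB.instance Definition _ :=
  Measure_isProbability.Build _ _ _ iid_law iid_law_setT.

Lemma iid_law_cylinder n q : iid_law (@cylinder _ s0 n q) =
  ((q 0%N == s0)%:R * \prod_(i < n) p (q i.+1))%:E.
Proof.
rewrite /iid_law /leb01 /= /mrestr coder_cylinder.
case: eqP => _; last by rewrite measure0 mul0r.
rewrite lebesgue_measure_itv /= lte_fin ltrDl width_gt0.
rewrite -EFinD addrAC subrr add0r mul1r; congr EFin.
by rewrite /width big_map -(big_mkord xpredT (fun i => p (q i.+1))) /index_iota subn0.
Qed.

Lemma exists_iid_law : exists P : probability T R, forall n q,
  P (@cylinder _ s0 n q) = ((q 0%N == s0)%:R * \prod_(i < n) p (q i.+1))%:E.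
Proof. by exists iid_law; exact: iid_law_cylinder. Qed.

End Digits.

(** Every path measure gives the drift as expected mean payoff, which serves both directions; the
    converse also takes the measure constructed from digits. *)
Lemma log_mp_yes_iid (R : realType) e (He : prob_rewards e) :
  log_mp_yes R (iid_instance He) <-> 0 < drift R e.
Proof.
pose p (s : 'I_(size e)) : R := ratr (nth (0, 0) e s).1.
have p_gt0 s : 0 < p s by rewrite ltr0q; case/andP: (iid_gt0 He s).
have p_sum : \sum_s p s = 1.
  have [_ Hsum] := iid_markov He.
  by rewrite -(rmorph1 (@ratr R)) -(Hsum (iid_start He)) rmorph_sum.
have E (P : probability (path_sigma (iid_start He)) R) :
    is_path_measure (@iid_trans e) P ->
    expected_mean_payoff
      (fun s : 'I_(size e) => ln (ratr (iid_reward s)) : R) P = (drift R e)%:E.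
  move=> HP; rewrite (@expected_mean_payoff_iid _ _ _ p) //.
  - by rewrite /drift (big_nth (0, 0)) big_mkord.
  - by move=> s; apply: ltW.
split=> [[P HP]|He0]; first by rewrite E.
have [P HP] := @exists_iid_law R (size e) p (iid_start He) p_gt0 p_sum.
have HP' : is_path_measure (@iid_trans e) P by exact: HP.
by exists P => //; rewrite E // lte_fin.
Qed.

Theorem mainTheorem3 (R : realType) : polytime_reducible CSRI (LogMP R).
Proof.
exists reduction; split; first exact: reduction_computable.
by apply: reduction_correct; exact: log_mp_yes_iid.
Qed.
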